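(* Let $\mathbf{k}$ be an algebraically closed field of characteristic different from $2$ and $3$, let $\tau$ be a positive integer, and let $\mathcal{H}=\langle 6,2+6\tau,3+6\tau,4+6\tau,5+6\tau\rangle$, a symmetric semigroup of genus $g=6\tau+1$. Let $\overline{\mathscr{M}}_{\mathcal{H}}$ be the compactified moduli space of pointed complete integral Gorenstein curves with Weierstrass semigroup $\mathcal{H}$. Then $$\dim\overline{\mathscr{M}}_{\mathcal{H}}\le 8\tau+5,$$ which for each $\tau>1$ is smaller than $2g-1=12\tau+1$.
   Context: $\overline{\mathscr{M}}_{\mathcal{H}}$ is realized explicitly as the quotient $(\mathcal{X}\setminus\{0\})/\mathbb{G}_m$, where $\mathcal{X}$ is the following closed subset of a weighted affine space; the $\mathbb{G}_m$-orbits on $\mathcal{X}$ correspond bijectively to the isomorphism classes of pointed complete integral Gorenstein curves $(\mathcal{C},P)$, $P$ a smooth point with Weierstrass semigroup $\mathcal{H}$ (the set of $n\ge 0$ that are pole orders $nP$ of rational functions on $\mathcal{C}$), and the origin, corresponding to the monomial curve, is excluded. Consider unknown coefficients $g_{ir}$, $f_{ir}$ of weight $r$, arranged as polynomials in one variable $t$: for each residue $j\in\{1,\dots,6\}$, the partial polynomial $g_i^{(j)}=\sum_{r\equiv j\bmod 6}g_{ir}t^r$ (similarly $f_i^{(j)}$), where $r$ runs over the positive integers $\equiv j \bmod 6$ not larger than the formal degree of the partial polynomial. Put $$\begin{aligned} g_4&=g_4^{(1)}+g_4^{(2)}+g_4^{(4)}+g_4^{(5)}+g_4^{(6)}, & f_6&=f_6^{(1)}+f_6^{(3)}+f_6^{(4)}+f_6^{(6)},\\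 g_5&=g_5^{(1)}+g_5^{(2)}+g_5^{(3)}+g_5^{(5)}+g_5^{(6)}, & f_8&=f_8^{(2)}+f_8^{(4)}+f_8^{(5)}+f_8^{(6)},\\ g_6&=g_6^{(1)}+g_6^{(2)}+g_6^{(3)}+g_6^{(4)}+g_6^{(6)}, & f_9&=f_9^{(1)}+f_9^{(3)}+f_9^{(6)},\\ g_7&=g_7^{(1)}+g_7^{(2)}+g_7^{(3)}+g_7^{(4)}+g_7^{(5)}, & f_{10}&=f_{10}^{(1)}+f_{10}^{(2)}+f_{10}^{(4)}+f_{10}^{(5)}+f_{10}^{(6)},\\ g_8&=g_8^{(2)}+g_8^{(3)}+g_8^{(4)}+g_8^{(5)}+g_8^{(6)}. \end{aligned}$$ Formal degrees: $g_4^{(4)},g_5^{(5)},g_6^{(6)},f_6^{(6)},g_7^{(1)},g_8^{(2)},f_8^{(2)},f_9^{(3)},f_{10}^{(4)}$ have formal degree $i+12\tau$ ($i$ the lower index); $g_4^{(5)},g_4^{(6)},g_5^{(6)}$ have formal degree $j+6(\tau-1)$; $f_9^{(1)},f_{10}^{(1)},f_{10}^{(2)}$ have formal degree $j+6(\tau+1)$; the remaining 26 partial polynomials have formal degree $j+6\tau$. Moreover $g_{41}=g_{42}=g_{46}=0$. This leaves $50\tau+43$ unknown coefficients, and $\mathcal{X}\subset\mathbf{k}^{50\tau+43}$ is the set of vectors of coefficients satisfying the following five polynomial identities in $t$: $$\begin{aligned} g_4-f_6+g_8&=f_6^{(1)}f_9+f_6^{(3)}g_7+(f_6^{(4)}-g_8^{(4)})f_6-g_8^{(5)}g_5-g_8^{(6)}g_4,\\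 g_5-f_6+f_9&=f_6^{(1)}f_{10}+f_6^{(3)}f_8-f_9^{(6)}g_5-f_9^{(1)}g_4,\\ g_6-f_6-f_8+f_9&=f_8^{(4)}g_8+f_8^{(5)}g_7-f_9^{(6)}g_6+f_8^{(6)}f_6-f_9^{(1)}g_5,\\ g_7-f_8+f_{10}&=f_8^{(4)}f_9+(f_8^{(5)}-f_{10}^{(5)})f_8-f_{10}^{(6)}g_7-f_{10}^{(1)}g_6-f_{10}^{(2)}g_5,\\ g_8-f_8-f_9+f_{10}&=f_9^{(6)}f_8-f_{10}^{(5)}f_9-f_{10}^{(6)}g_8-f_{10}^{(1)}g_7-f_{10}^{(2)}f_6. \end{aligned}$$ $\mathbb{G}_m=\mathbf{k}^*$ acts by $g_{ij}\mapsto c^jg_{ij}$, $f_{ij}\mapsto c^jf_{ij}$. *)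

(* Defs.v *)
From HB Require Import structures.
(* The notations of mpoly clash with those of the analysis library. *)
From mathcomp Require Import -(notations) mpoly.
From mathcomp Require Import all_boot all_order all_algebra.
From mathcomp Require Import all_classical topology.
From mathcomp Require Import zify.

Set Implicit Arguments.
Unset Strict Implicit.
Unset Printing Implicit Defensive.

Import GRing.Theory.
Local Open Scope classical_set_scope.
Local Open Scope ring_scope.

Section NumericalSemigroups.
Local Open Scope nat_scope.

Definition generated_semigroup (s : seq nat) : set nat :=
  [set n | exists a : nat -> nat, n = \sum_(i < size s) a i * nth 0 s i].

Definition has_genus (H : set nat) (g : nat) : Prop := (~` H #= `I_g)%card.

(* l is the Frobenius number, i.e. the largest gap of H. *)
Definition symmetric_semigroup (H : set nat) : Prop :=
  exists l, [/\ ~ H l, forall n, l < n -> H n &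
                forall n, n <= l -> (H n <-> ~ H (l - n))].

End NumericalSemigroups.

Definition irreducible_set (T : topologicalType) (Z : set T) : Prop :=
  Z !=set0 /\
  forall A B : set T, closed A -> closed B ->
    Z `<=` A `|` B -> Z `<=` A \/ Z `<=` B.

(* dim T <= d, where dim T is the supremum of the lengths n of the chains
   Z 0 < Z 1 < ... < Z n of irreducible closed subsets of T. *)
Definition dim_le (T : topologicalType) (d : nat) : Prop :=
  forall (n : nat) (Z : nat -> set T),
    (forall i, (i <= n)%N -> closed (Z i) /\ irreducible_set (Z i)) ->
    (forall i, (i < n)%N -> Z i `<` Z i.+1) ->
    (n <= d)%N.

Definition affine (k : fieldType) (n : nat) : Type := n.-tuple k.

Section Zariski.
Context {k : fieldType} {n : nat}.

HB.instance Definition _ := Choice.on (affine k n).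

Definition zero_locus (S : set (mpoly n k)) : set (affine k n) :=
  [set x | forall p, S p -> meval (tnth x) p = 0].

Definition zariski_open (U : set (affine k n)) : Prop :=
  exists S, ~` U = zero_locus S.

Lemma zariski_openT : zariski_open setT.
Proof.
exists [set 1]; rewrite setCT; apply/seteqP; split=> // x /(_ 1 erefl).
by rewrite meval1 => /eqP; rewrite oner_eq0.
Qed.

Lemma zariski_openI : setI_closed zariski_open.
Proof.
move=> U V [S US] [S' VS]; exists [set p * q | p in S & q in S'].
rewrite setCI US VS; apply/seteqP; split=> x /=.
  move=> [] h _ [p Sp [q Sq <-]]; rewrite mevalM.
    by rewrite (h p Sp) mul0r.
  by rewrite (h q Sq) mulr0.
move=> h; have [zS|/existsNP [p /not_implyP[Sp px]]] := pselect (zero_locus S x).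
  by left.
right=> q Sq; apply/eqP; move/eqP/negbTE: px => px.
by have /eqP := h _ (ex_intro2 _ _ p Sp (ex_intro2 _ _ q Sq erefl));
   rewrite mevalM mulf_eq0 px.
Qed.

Lemma zariski_open_bigcup (I : Type) (U : I -> set (affine k n)) :
  (forall i, zariski_open (U i)) -> zariski_open (\bigcup_i U i).
Proof.
move=> /choice [S US]; exists (\bigcup_i S i); rewrite setC_bigcup.
apply/seteqP; split=> x /= h.
  by move=> p [i _ Sp]; move: (h i Logic.I); rewrite US; exact.
by move=> i _; rewrite US => p Sp; apply: h; exists i.
Qed.

HB.instance Definition _ := isOpenTopological.Build (affine k n)
  zariski_openT zariski_openI zariski_open_bigcup.

End Zariski.

Variant letter := Lg | Lf.

Definition bool_of_letter (s : letter) : bool := if s is Lg then true else false.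
Definition letter_of_bool (b : bool) : letter := if b then Lg else Lf.

Lemma bool_of_letterK : cancel bool_of_letter letter_of_bool.
Proof. by case. Qed.

HB.instance Definition _ := Countable.copy letter (can_type bool_of_letterK).

Section Coefficients.
Local Open Scope nat_scope.

(* The letters g_i and f_i, encoded as (Lg, i) and (Lf, i), each with the list of
   the residues j of its partial polynomials; the residue 0 is written 6, so
   that all exponents are positive. *)
Definition letters : seq (letter * nat * seq nat) :=
  [:: (Lg, 4, [:: 1; 2; 4; 5; 6]); (Lg, 5, [:: 1; 2; 3; 5; 6]);
      (Lg, 6, [:: 1; 2; 3; 4; 6]); (Lg, 7, [:: 1; 2; 3; 4; 5]);
      (Lg, 8, [:: 2; 3; 4; 5; 6]);
      (Lf, 6, [:: 1; 3; 4; 6]); (Lf, 8, [:: 2; 4; 5; 6]);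
      (Lf, 9, [:: 1; 3; 6]); (Lf, 10, [:: 1; 2; 4; 5; 6])].

Definition partials : seq (letter * nat * nat) :=
  [seq (l.1, j) | l <- letters, j <- l.2].

Definition formal_degree (tau : nat) (p : letter * nat * nat) : nat :=
  let: (_, i, j) := p in
  if p \in [:: (Lg, 4, 4); (Lg, 5, 5); (Lg, 6, 6); (Lf, 6, 6); (Lg, 7, 1);
               (Lg, 8, 2); (Lf, 8, 2); (Lf, 9, 3); (Lf, 10, 4)]
  then i + 12 * tau
  else if p \in [:: (Lg, 4, 5); (Lg, 4, 6); (Lg, 5, 6)] then j + 6 * (tau - 1)
  else if p \in [:: (Lf, 9, 1); (Lf, 10, 1); (Lf, 10, 2)] then j + 6 * (tau + 1)
  else j + 6 * tau.

Definition exponents (tau : nat) (p : letter * nat * nat) : seq nat :=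
  [seq r <- iota 1 (formal_degree tau p) | r == p.2 %[mod 6]].

(* (s, i, r) stands for the unknown coefficient g_{ir} or f_{ir}, of weight r. *)
Definition coeffs (tau : nat) : seq (letter * nat * nat) :=
  [seq c <- [seq (p.1, r) | p <- partials, r <- exponents tau p]
     | c \notin [:: (Lg, 4, 1); (Lg, 4, 2); (Lg, 4, 6)]].

Lemma partials_residue p : p \in partials -> 0 < p.2 <= 6.
Proof. by apply/allP: p. Qed.

Lemma uniq_pairs tau :
  uniq [seq (p.1, r) | p <- partials, r <- exponents tau p].
Proof.
apply: allpairs_uniq_dep => //.
  by move=> p _; rewrite filter_uniq ?iota_uniq.
move=> [p r] [q r'] /allpairsPdep[p' [s [pin sin [-> ->]]]].
move=> /allpairsPdep[q' [s' [qin s'in [-> ->]]]] /= [e es].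
rewrite -{s'}es in s'in *.
move: sin s'in; rewrite !mem_filter => /andP[/eqP e1 _] /andP[/eqP e2 _].
have e3 : p'.2 = q'.2.
  move: e1 e2 (partials_residue pin) (partials_residue qin) => /=.
  by move: (p'.2) (q'.2) => a b; lia.
by have -> : p' = q' by rewrite [p']surjective_pairing e e3 -surjective_pairing.
Qed.

Lemma uniq_coeffs (tau : nat) : uniq (coeffs tau).
Proof. exact/filter_uniq/uniq_pairs. Qed.

Lemma size_exponents tau (p : letter * nat * nat) : 0 < p.2 <= 6 ->
  size (exponents tau p) = (formal_degree tau p + 6 - p.2) %/ 6.
Proof.
rewrite /exponents; elim: (formal_degree _ _) => [|d IH] jP; first by rewrite /=; lia.
have -> : iota 1 d.+1 = rcons (iota 1 d) d.+1
  by rewrite -cats1 -[d.+1 in LHS]addn1 iotaD.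
rewrite filter_rcons (fun_if size) size_rcons (IH jP); move: (p.2) jP => j jP.
by case: eqP; lia.
Qed.

Lemma size_coeffs (tau : nat) : 0 < tau -> size (coeffs tau) = 50 * tau + 43.
Proof.
move=> tau0; pose z := [:: (Lg, 4, 1); (Lg, 4, 2); (Lg, 4, 6)].
set s := [seq (p.1, r) | p <- partials, r <- exponents tau p].
have <- : size s - 3 = 50 * tau + 43.
  rewrite /s size_allpairs_dep.
  have e p : p \in partials ->
      size (exponents tau p) = (formal_degree tau p + 6 - p.2) %/ 6.
    by move=> /partials_residue; exact: size_exponents.
  have/eq_in_map -> := e.
  by rewrite /formal_degree /=; lia.
have -> : 3 = size [seq c <- s | c \in z].
  apply: (@perm_size _ z); apply: uniq_perm => //.
    by rewrite filter_uniq // uniq_pairs.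
  move=> c; rewrite mem_filter andb_idr //.
  have mem_s p r : p \in partials -> r \in exponents tau p -> (p.1, r) \in s.
    by move=> pP rP; apply/allpairsPdep; exists p, r.
  apply/allP: c; apply/and4P; split; last by [].
  - by apply: (@mem_s (Lg, 4, 1) 1) => //; rewrite /exponents mem_filter
      mem_iota /formal_degree; case: (tau) tau0 => //= *; lia.
  - by apply: (@mem_s (Lg, 4, 2) 2) => //; rewrite /exponents mem_filter
      mem_iota /formal_degree; case: (tau) tau0 => //= *; lia.
  - by apply: (@mem_s (Lg, 4, 6) 6) => //; rewrite /exponents mem_filter
      mem_iota /formal_degree; case: (tau) tau0 => //= *; lia.
by rewrite !size_filter -(count_predC (mem z) s) addKn.
Qed.

End Coefficients.

Section ModuliSpace.
Variables (k : fieldType) (tau : nat).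

Notation space := (affine k (size (coeffs tau))).

(* The default value of nth makes the coefficients g_{41}, g_{42}, g_{46},
   which do not occur in coeffs, vanish. *)
Definition coeff (x : space) (c : letter * nat * nat) : k :=
  nth 0 x (index c (coeffs tau)).

Definition partial_poly (x : space) (s : letter) (i j : nat) : {poly k} :=
  \sum_(r <- exponents tau (s, i, j)) coeff x (s, i, r) *: 'X^r.

Definition full_poly (x : space) (s : letter) (i : nat) : {poly k} :=
  \sum_(p <- partials | p.1 == (s, i)) partial_poly x s i p.2.

Section Equations.
Variable x : space.
Local Notation g i := (full_poly x Lg i).
Local Notation f i := (full_poly x Lf i).
Local Notation gp i j := (partial_poly x Lg i j).
Local Notation fp i j := (partial_poly x Lf i j).

Definition equations : Prop :=
  [/\ g 4 - f 6 + g 8 =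
        fp 6 1 * f 9 + fp 6 3 * g 7 + (fp 6 4 - gp 8 4) * f 6
        - gp 8 5 * g 5 - gp 8 6 * g 4,
      g 5 - f 6 + f 9 =
        fp 6 1 * f 10 + fp 6 3 * f 8 - fp 9 6 * g 5 - fp 9 1 * g 4,
      g 6 - f 6 - f 8 + f 9 =
        fp 8 4 * g 8 + fp 8 5 * g 7 - fp 9 6 * g 6 + fp 8 6 * f 6
        - fp 9 1 * g 5,
      g 7 - f 8 + f 10 =
        fp 8 4 * f 9 + (fp 8 5 - fp 10 5) * f 8 - fp 10 6 * g 7
        - fp 10 1 * g 6 - fp 10 2 * g 5 &
      g 8 - f 8 - f 9 + f 10 =
        fp 9 6 * f 8 - fp 10 5 * f 9 - fp 10 6 * g 8 - fp 10 1 * g 7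
        - fp 10 2 * f 6].

End Equations.

Definition variety : set space := [set x | equations x].

Definition origin : space := [tuple 0 | _ < size (coeffs tau)].

Definition punctured_variety : set space := variety `\ origin.

Definition weight (i : 'I_(size (coeffs tau))) : nat :=
  (tnth (in_tuple (coeffs tau)) i).2.

Definition gm_act (c : k) (x : space) : space :=
  [tuple c ^+ weight i * tnth x i | i < size (coeffs tau)].

Definition same_orbit (x y : punctured_variety) : bool :=
  `[< exists2 c : k, c != 0 & set_val y = gm_act c (set_val x) >].

Lemma same_orbit_refl : reflexive same_orbit.
Proof.
move=> x; apply/asboolP; exists 1; first exact: oner_neq0.
by apply: eq_from_tnth => i; rewrite tnth_mktuple expr1n mul1r.
Qed.

Lemma same_orbit_sym : symmetric same_orbit.
Proof.
suff h x y : same_orbit x y -> same_orbit y x by move=> x y; apply/idP/idP; exact: h.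
move=> /asboolP[c c0 yx]; apply/asboolP; exists c^-1; first by rewrite invr_eq0.
apply: eq_from_tnth => i; rewrite tnth_mktuple yx tnth_mktuple mulrA -exprMn.
by rewrite mulVf// expr1n mul1r.
Qed.

Lemma same_orbit_trans : transitive same_orbit.
Proof.
move=> y x z /asboolP[c c0 yx] /asboolP[d d0 zy]; apply/asboolP.
exists (d * c); first by rewrite mulf_neq0.
by apply: eq_from_tnth => i; rewrite zy yx !tnth_mktuple exprMn mulrA.
Qed.

Canonical same_orbit_equiv :=
  EquivRel same_orbit same_orbit_refl same_orbit_sym same_orbit_trans.

(* The orbit space, with the quotient of the Zariski topology of the punctured
   variety; its points are the isomorphism classes of the pointed Gorenstein
   curves with semigroup <6, 2+6tau, 3+6tau, 4+6tau, 5+6tau>. *)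
Definition moduli_space : Type :=
  quotient_topology {eq_quot same_orbit_equiv}%qT.

HB.instance Definition _ := Topological.on moduli_space.

End ModuliSpace.

(* Main.v *)
Require Import Defs.
From mathcomp Require Import all_boot all_order all_algebra.
From mathcomp Require Import all_classical topology.
(* The notations of mpoly clash with those of the analysis library. *)
From mathcomp Require Import -(notations) mpoly.
From mathcomp Require Import zify ring.

(* After elimination of the linear terms of the equations, the coordinate ring of X is
   generated by 11 tau + 6 "essential" coefficients.  In high degree the identities have
   no linear terms left; their quadratic parts express that certain polynomials satisfy,
   in high degree, the Pfaffian equations of the Grassmannian G(2, 5).  Degenerating three
   of the five Pfaffians to monomials, one sees that the products
     g_8^(5) f_8^(4),   g_8^(4) f_6^(1),   f_10^(2) f_6^(3)
   vanish in high degree in an associated graded ring; the product of a coefficient of one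
   factor and a coefficient of the other is then nilpotent in that ring as soon as its
   total degree is high.  Hence the functions of weight w on X are spanned by monomials
   with at most 8 tau + 6 large exponents, and form a space of dimension
   O(w^(8 tau + 5)).

   On the other hand, a chain of length n of irreducible closed subsets of the orbit space
   yields n + 1 homogeneous functions on X that are algebraically independent, so that the
   dimension in weight w grows at least like w^n along a sequence of weights.  Therefore
   n <= 8 tau + 5. *)

Set Implicit Arguments.
Unset Strict Implicit.
Unset Printing Implicit Defensive.

Import GRing.Theory.

(** * The semigroup: membership, symmetry and genus *)

Section Semigroup.
Local Open Scope nat_scope.
Local Open Scope classical_set_scope.
Variable tau : nat.
Hypothesis tau_gt0 : 0 < tau.

Let H := generated_semigroup [:: 6; 2 + 6 * tau; 3 + 6 * tau; 4 + 6 * tau; 5 + 6 * tau].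

(* 7 + 12 tau = (2 + 6 tau) + (5 + 6 tau) is the least element of residue 1. *)
Lemma mem_semigroup n : H n <->
  [\/ n %% 6 = 0, n %% 6 = 1 /\ 7 + 12 * tau <= n | 1 < n %% 6 /\ n %% 6 + 6 * tau <= n].
Proof.
have mem (a b c d e : nat) : n = 6 * a + (2 + 6 * tau) * b + (3 + 6 * tau) * c +
    (4 + 6 * tau) * d + (5 + 6 * tau) * e -> H n.
  move=> ->; exists (nth 0 [:: a; b; c; d; e]).
  by rewrite !big_ord_recl big_ord0 /= /bump /= !(mulnC a, mulnC b, mulnC c, mulnC d, mulnC e); lia.
split=> [[a ->]|].
  rewrite !big_ord_recl big_ord0 /= /bump /= !addn0.
  set a0 := a 0; set b := a _; set c := a _; set d := a _; set e := a _.
  pose s := b + c + d + e.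
  have -> : a0 * 6 + (b * (2 + 6 * tau) + (c * (3 + 6 * tau) + (d * (4 + 6 * tau) +
    e * (5 + 6 * tau)))) = 6 * (a0 + tau * s) + (2 * b + 3 * c + 4 * d + 5 * e).
    by rewrite /s; nia.
  have [s0|s1|s2] : [\/ s = 0, s = 1 | 2 <= s] by move: (s) => [|[|]]; [constructor 1|constructor 2|constructor 3].
  - by constructor 1; rewrite /s in s0; lia.
  - by constructor 3; rewrite s1; rewrite /s in s1; lia.
  have : 2 * tau <= tau * s by rewrite mulnC leq_mul2l s2 orbT.
  move: (tau * s) => m hm; rewrite /s in s2.
  have [h|h|h] : [\/ (2 * b + 3 * c + 4 * d + 5 * e) %% 6 = 0,
     (2 * b + 3 * c + 4 * d + 5 * e) %% 6 = 1 | 1 < (2 * b + 3 * c + 4 * d + 5 * e) %% 6].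
  - by move: (_ %% 6) => [|[|]]; [constructor 1|constructor 2|constructor 3].
  - by constructor 1; lia.
  - by constructor 2; lia.
  - by constructor 3; lia.
case=> [h|[h1 h2]|[h1 h2]].
- by apply: (mem (n %/ 6) 0 0 0 0); lia.
- by apply: (mem ((n - (7 + 12 * tau)) %/ 6) 1 0 0 1); lia.
have : n %% 6 < 6 by lia.
case e : (n %% 6) h1 h2 => [//|[//|[|[|[|[|//]]]]]] _ h2 _.
- by apply: (mem ((n - (2 + 6 * tau)) %/ 6) 1 0 0 0); lia.
- by apply: (mem ((n - (3 + 6 * tau)) %/ 6) 0 1 0 0); lia.
- by apply: (mem ((n - (4 + 6 * tau)) %/ 6) 0 0 1 0); lia.
- by apply: (mem ((n - (5 + 6 * tau)) %/ 6) 0 0 0 1); lia.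
Qed.

Lemma semigroup_symmetric : symmetric_semigroup H.
Proof.
(* The largest gap has residue 1: it is one step of 6 below [7 + 12 * tau]. *)
exists (12 * tau + 1); split.
- by rewrite mem_semigroup => -[]; lia.
- move=> n hn; apply/mem_semigroup.
  have [h|h|h] : [\/ n %% 6 = 0, n %% 6 = 1 | 1 < n %% 6].
  + by move: (n %% 6) => [|[|]]; [constructor 1|constructor 2|constructor 3].
  + by constructor 1.
  + by constructor 2; lia.
  + by constructor 3; lia.
move=> n hn; split.
  by rewrite !mem_semigroup => -[?|?|?] [?|?|?]; lia.
move=> h; apply/mem_semigroup; apply: contrapT => h'; apply: h; apply/mem_semigroup.
have {h'} [h1 h2 h3] : [/\ n %% 6 <> 0, ~ (n %% 6 = 1 /\ 7 + 12 * tau <= n) &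
   ~ (1 < n %% 6 /\ n %% 6 + 6 * tau <= n)].
  by split=> h; apply: h'; [constructor 1|constructor 2|constructor 3].
have [e|[e|e]] : n %% 6 = 1 \/ n %% 6 = 5 \/ 1 < n %% 6 < 5 by lia.
- by constructor 1; lia.
- by constructor 3; lia.
- by constructor 3; lia.
Qed.

Lemma semigroup_genus : has_genus H (6 * tau + 1).
Proof.
rewrite /has_genus card_eq_sym; apply/card_set_bijP.
(* [f] lists first the [2 * tau + 1] gaps of residue 1, up to [12 * tau + 1], then the [4 * tau]
   gaps of residues 2 to 5 below [6 * tau], four in each block of length 6. *)
pose f n := if n < 2 * tau + 1 then 1 + 6 * n
  else 2 + (n - (2 * tau + 1)) %% 4 + 6 * ((n - (2 * tau + 1)) %/ 4).
exists f; split.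
- move=> n /= hn; rewrite mem_semigroup /f; case: ifP => h -[]; lia.
- by move=> n m; rewrite !inE /= /f => hn hm; do 2 case: ifP; lia.
move=> n /= hn.
have {hn} [h1 h2 h3] : [/\ n %% 6 <> 0, ~ (n %% 6 = 1 /\ 7 + 12 * tau <= n) &
   ~ (1 < n %% 6 /\ n %% 6 + 6 * tau <= n)].
  by split=> h; apply: hn; apply/mem_semigroup; [constructor 1|constructor 2|constructor 3].
have [e|e] : n %% 6 = 1 \/ 1 < n %% 6 by lia.
  by exists (n %/ 6); rewrite /f /=; [lia | case: ifP; lia].
exists (2 * tau + 1 + (4 * (n %/ 6) + (n %% 6 - 2))); rewrite /f /=; first lia.
by case: ifP; lia.
Qed.

End Semigroup.

(** * Spans of monomials in the coordinate functions *)

Section MonomialSpan.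
Local Open Scope ring_scope.
Context {k : fieldType} {N : nat} {T : Type} (ev : T -> 'I_N -> k).
Implicit Types (P Q : multinom N -> Prop) (phi psi : T -> k).

Definition evalf (q : mpoly N k) : T -> k := fun t => meval (ev t) q.

Lemma evalfD p q : evalf (p + q) = evalf p + evalf q.
Proof. by apply/funext => t; rewrite /evalf mevalD. Qed.

Lemma evalfM p q : evalf (p * q) = evalf p * evalf q.
Proof. by apply/funext => t; rewrite /evalf mevalM. Qed.

Lemma evalfZ c p : evalf (c *: p) = cst c * evalf p.
Proof. by apply/funext => t; rewrite /evalf mevalZ. Qed.

Lemma evalf0 : evalf 0 = 0.
Proof. by apply/funext => t; rewrite /evalf meval0. Qed.

Lemma evalf1 : evalf 1 = 1.
Proof. by apply/funext => t; rewrite /evalf meval1. Qed.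

Definition mon (m : multinom N) : T -> k := evalf (mpolyX k m).

Definition coordf (i : 'I_N) : T -> k := fun t => ev t i.

Lemma mon1 i : mon (mnm1 i) = coordf i.
Proof. by apply/funext => t; rewrite /mon /evalf mevalXU. Qed.

Lemma mon0 : mon (@mnm0 N) = 1.
Proof. by rewrite /mon mpolyX0 evalf1. Qed.

Lemma monD m m' : mon (mnm_add m m') = mon m * mon m'.
Proof. by rewrite /mon mpolyXD evalfM. Qed.

Lemma mon_prod m : mon m = \prod_i coordf i ^+ m i.
Proof.
apply/funext => t; rewrite /mon /evalf mevalX fct_prodE; apply: eq_bigr => i _.
by elim: (m i) => [//|e IH]; rewrite exprS IH exprS.
Qed.

Lemma evalfE (q : mpoly N k) (s : seq (multinom N)) : uniq s ->
  {subset msupp q <= s} -> evalf q = \sum_(m <- s) cst (mcoeff m q) * mon m.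
Proof.
move=> us qs; rewrite {1}(mpolyE q) (big_morph evalf evalfD evalf0).
under eq_bigr => m _ do rewrite evalfZ.
rewrite [RHS](bigID (fun m => m \in msupp q)) /= [X in _ + X]big1 ?addr0; last first.
  by move=> m; rewrite -mcoeff_eq0 => /eqP ->; rewrite [LHS]mul0r.
rewrite -[RHS]big_filter; apply: perm_big; apply: uniq_perm.
- exact: msupp_uniq.
- exact: filter_uniq.
- by move=> m; rewrite mem_filter; case: (boolP (_ \in msupp q)) => // /qs ->.
Qed.

(** Functions on [T] stand in for the coordinate ring: a relation that holds on the variety is an
    equality here, and [q] is one representative among possibly many. *)
Definition mspan P phi :=
  exists2 q, (forall m, m \in msupp q -> P m) & phi = evalf q.

Lemma mspan_mon P m : P m -> mspan P (mon m).
Proof. by move=> Pm; exists (mpolyX k m) => // m'; rewrite msuppX inE => /eqP->. Qed.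

Lemma mspan0 P : mspan P 0.
Proof. by exists 0; rewrite ?evalf0 // => m; rewrite msupp0. Qed.

Lemma mspanD P phi psi : mspan P phi -> mspan P psi -> mspan P (phi + psi).
Proof.
move=> [p Pp ->] [q Pq ->]; exists (p + q); last by rewrite evalfD.
by move=> m /msuppD_le; rewrite mem_cat => /orP[/Pp|/Pq].
Qed.

Lemma mspanZ P c phi : mspan P phi -> mspan P (cst c * phi).
Proof.
move=> [p Pp ->]; exists (c *: p); last by rewrite evalfZ.
by move=> m /msuppZ_le /Pp.
Qed.

Lemma mspanN P phi : mspan P phi -> mspan P (- phi).
Proof. by move=> h; rewrite -mulN1r; exact: (mspanZ (-1)). Qed.

Lemma mspanB P phi psi : mspan P phi -> mspan P psi -> mspan P (phi - psi).
Proof. by move=> p q; apply: mspanD => //; exact: mspanN. Qed.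

Lemma mspan_sum P (I : Type) (r : seq I) (S : pred I) (F : I -> T -> k) :
  (forall i, S i -> mspan P (F i)) -> mspan P (\sum_(i <- r | S i) F i).
Proof. by move=> h; apply: big_ind => //; [exact: mspan0 | exact: mspanD]. Qed.

Lemma mspanM P Q (R : multinom N -> Prop) phi psi :
  (forall m m', P m -> Q m' -> R (mnm_add m m')) ->
  mspan P phi -> mspan Q psi -> mspan R (phi * psi).
Proof.
move=> h [p Pp ->] [q Qq ->]; exists (p * q); last by rewrite evalfM.
by move=> m /msuppM_le /allpairsP[[a b] /= [/Pp Pa /Qq Qb ->]]; exact: h.
Qed.

Lemma mspan_bind P Q phi :
  (forall m, P m -> mspan Q (mon m)) -> mspan P phi -> mspan Q phi.
Proof.
move=> h [p Pp ->]; rewrite (evalfE (msupp_uniq p)) // big_seq.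
by apply: mspan_sum => m /Pp /h; exact: mspanZ.
Qed.

Lemma mspan_sub P Q phi : (forall m, P m -> Q m) -> mspan P phi -> mspan Q phi.
Proof. by move=> h; apply: mspan_bind => m /h; exact: mspan_mon. Qed.

End MonomialSpan.

(** * The filtration by rank and nilpotents of its associated graded ring *)

Section WeightedFiltration.
Local Open Scope ring_scope.
Context {k : fieldType} {N : nat} {T : Type} (ev : T -> 'I_N -> k).
Variable wt : 'I_N -> nat.
Implicit Types (U : {pred 'I_N}) (rk : 'I_N -> nat) (phi psi : T -> k).

Definition mstat (f : 'I_N -> nat) (m : multinom N) : nat :=
  (\sum_i f i * m i)%N.

Lemma mstatD f m m' : mstat f (mnm_add m m') = (mstat f m + mstat f m')%N.
Proof.
by rewrite /mstat -big_split; apply: eq_bigr => i _; rewrite mnmDE mulnDr.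
Qed.

Lemma mstat0 f : mstat f (@mnm0 N) = 0%N.
Proof. by rewrite /mstat big1 // => i _; rewrite mnm0E muln0. Qed.

Lemma mstat1 f i : mstat f (mnm1 i) = f i.
Proof.
rewrite /mstat (bigD1 i) //= mnm1E eqxx muln1 big1 ?addn0 // => j ji.
by rewrite mnm1E eq_sym (negbTE ji) muln0.
Qed.

Definition supported U (m : multinom N) := forall i, (0 < m i)%N -> U i.

(** A filtration, decreasing in [r], of the functions of weight [w]. Two instances matter: all
    variables with rank 1, which is the filtration by degree; and the essential variables with the
    ranks [rank_of]. *)
Definition fil U rk r w : (T -> k) -> Prop :=
  mspan ev (fun m => [/\ supported U m, (r <= mstat rk m)%N & mstat wt m = w]).

Section Fixed.
Variables (U : {pred 'I_N}) (rk : 'I_N -> nat).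
Local Notation Fil := (fil U rk).

Lemma fil_mon m r : supported U m -> (r <= mstat rk m)%N ->
  Fil r (mstat wt m) (mon ev m).
Proof. by move=> s h; exact: mspan_mon. Qed.

Lemma fil_coord i : U i -> Fil (rk i) (wt i) (coordf ev i).
Proof.
move=> Ui; rewrite -mon1 -(mstat1 wt i); apply: fil_mon; last by rewrite mstat1.
by move=> j; rewrite mnm1E lt0b => /eqP <-.
Qed.

Lemma fil1 : Fil 0 0 1.
Proof.
rewrite -(mon0 ev); apply: mspan_mon; split=> [i||]; rewrite ?mstat0 //.
by rewrite mnm0E.
Qed.

Lemma filM r w r' w' phi psi :
  Fil r w phi -> Fil r' w' psi -> Fil (r + r') (w + w') (phi * psi).
Proof.
apply: mspanM => m m' [s h <-] [s' h' <-]; split.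
- by move=> i; rewrite mnmDE addn_gt0 => /orP[/s|/s'].
- by rewrite mstatD leq_add.
- by rewrite mstatD.
Qed.

Lemma fil_le r r' w phi : (r' <= r)%N -> Fil r w phi -> Fil r' w phi.
Proof.
by move=> h; apply: mspan_sub => m [s t u]; split=> //; exact: leq_trans t.
Qed.

Lemma filX r w phi n : Fil r w phi -> Fil (n * r) (n * w) (phi ^+ n).
Proof.
move=> h; elim: n => [|n IH]; first by rewrite expr0; exact: fil1.
by rewrite exprS !mulSn; exact: filM.
Qed.

(* Nilpotency of the class of [phi] in the associated graded ring. *)
Definition gr_nilp r w phi := exists n, Fil (n * r + 1) (n * w) (phi ^+ n).

Lemma gr_nilp_fil r w phi : Fil r.+1 w phi -> gr_nilp r w phi.
Proof. by move=> h; exists 1; rewrite expr1 !mul1n addn1. Qed.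

Lemma gr_nilp_exp r w phi : Fil r w phi -> gr_nilp r w phi ->
  exists n0, forall n, (n0 <= n)%N -> Fil (n * r + 1) (n * w) (phi ^+ n).
Proof.
move=> h [n hn]; exists n => n' nn'; rewrite -(subnKC nn') exprD !mulnDl.
rewrite addnAC; apply: filM => //; exact: filX.
Qed.

Lemma gr_nilpM r w r' w' phi psi : Fil r w phi -> gr_nilp r' w' psi ->
  gr_nilp (r + r') (w + w') (phi * psi).
Proof.
move=> h [n hn]; exists n; rewrite exprMn !mulnDr -addnA; apply: filM => //.
exact: filX.
Qed.

Lemma gr_nilpN r w phi : gr_nilp r w phi -> gr_nilp r w (- phi).
Proof.
move=> [n hn]; exists n; rewrite exprNn; have [e|e] : (-1) ^+ n = 1 :> (T -> k) \/
  (-1) ^+ n = -1 :> (T -> k); first by rewrite -signr_odd; case: odd; [right|left].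
  by rewrite e mul1r.
by rewrite e mulN1r; exact: mspanN.
Qed.

(** With the sum of the two thresholds as exponent, every term of the binomial expansion has one of
    its powers past its threshold, which supplies the extra unit of rank. *)
Lemma gr_nilpD r w phi psi : Fil r w phi -> Fil r w psi ->
  gr_nilp r w phi -> gr_nilp r w psi -> gr_nilp r w (phi + psi).
Proof.
move=> f1 f2 /(gr_nilp_exp f1)[n hn] /(gr_nilp_exp f2)[n' hn'].
exists (n + n')%N; rewrite exprDn; apply: mspan_sum => i _.
rewrite -mulr_natl natmulfctE; apply: (mspanZ (_ *+ _)).
have iN : (i <= n + n')%N by rewrite -ltnS.
have e c : ((n + n') * c = (n + n' - i) * c + i * c)%N by rewrite -mulnDl subnK.
rewrite !e; have [ni|ni] := leqP n' i.
  by rewrite -addnA; apply: filM; [exact: filX | exact: hn'].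
rewrite addnAC; apply: filM; last exact: filX.
by apply: hn; lia.
Qed.

Lemma gr_nilp_sum (I : Type) (s : seq I) (S : pred I) (F : I -> T -> k) r w :
  (forall i, S i -> Fil r w (F i)) -> (forall i, S i -> gr_nilp r w (F i)) ->
  gr_nilp r w (\sum_(i <- s | S i) F i).
Proof.
move=> h1 h2; suff [] : Fil r w (\sum_(i <- s | S i) F i) /\
   gr_nilp r w (\sum_(i <- s | S i) F i) by [].
apply: (big_ind (fun x => Fil r w x /\ gr_nilp r w x)).
- by split; [exact: mspan0 | apply: gr_nilp_fil; exact: mspan0].
- by move=> x y [? ?] [? ?]; split; [exact: mspanD | exact: gr_nilpD].
- by move=> i Si; split; [exact: h1 | exact: h2].
Qed.

Lemma gr_nilp_sqr r w phi : gr_nilp (2 * r) (2 * w) (phi ^+ 2) -> gr_nilp r w phi.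
Proof. by move=> [n hn]; exists (2 * n)%N; rewrite exprM -!mulnA (mulnCA 2 n r) (mulnCA 2 n w). Qed.

(* In a reduced ring, a b = 0 modulo t^n forces a_i b_j = 0 for i + j < n: this is
   the corresponding statement at the other end of the polynomials. *)
Lemma gr_nilp_coef_prod (x y : nat -> T -> k) rx ry r0 B :
  (forall a, Fil rx a (x a)) -> (forall b, Fil ry b (y b)) ->
  (forall a, (B <= a)%N -> x a = 0) -> (forall b, (B <= b)%N -> y b = 0) ->
  (forall r, (r0 <= r)%N ->
     Fil (rx + ry).+1 r (\sum_(a < r.+1) x a * y (r - a)%N)) ->
  forall a b, (r0 <= a + b)%N -> gr_nilp (rx + ry) (a + b) (x a * y b).
Proof.
move=> fx fy x0 y0 rel a b.
(* Downward induction on [a + b]: from [2 * B] on, one of the two factors is zero. *)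
move: {2}(2 * B - (a + b))%N (leqnn (2 * B - (a + b))%N) => n.
elim: n a b => [|n IH] a b hn hr.
  apply: gr_nilp_fil; have [/x0->|aB] := leqP B a.
    by rewrite mul0r; exact: mspan0.
  by rewrite y0 ?mulr0; [exact: mspan0 | lia].
have {}IH c d : (a + b < c + d)%N -> gr_nilp (rx + ry) (c + d) (x c * y d).
  by move=> h; apply: IH; lia.
have ab : (a < (a + b).+1)%N by rewrite ltnS leq_addr.
have := rel _ hr; rewrite (bigD1 (Ordinal ab)) //= addKn.
set s := \sum_(_ < _ | _) _ => fs.
(* Multiplying the relation of degree [a + b] by [x a * y b] trades the square for cross terms
   [x a * y b * (x i * y (a + b - i))]. Each contains both [x i * y b] and [x a * y (a + b - i)];
   one of these has degree above [a + b], and the induction hypothesis applies to it. *)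
apply: gr_nilp_sqr.
have -> : (x a * y b) ^+ 2 =
    (x a * y b) * (x a * y b + s) - (x a * y b) * s.
  by rewrite mulrDr addrK expr2.
have fab : Fil (rx + ry) (a + b) (x a * y b) by exact: filM.
have fterm (i : 'I_(a + b).+1) : Fil (rx + ry) (a + b) (x i * y (a + b - i)%N).
  by have := filM (fx i) (fy (a + b - i)%N); rewrite subnKC // -ltnS.
have fsum : Fil (rx + ry) (a + b) s by apply: mspan_sum => i _; exact: fterm.
rewrite !mulSn !mul0n !addn0.
have f1 : Fil ((rx + ry) + (rx + ry)).+1 ((a + b) + (a + b))
            ((x a * y b) * (x a * y b + s)).
  by rewrite -addnS; exact: filM.
apply: gr_nilpD; first exact: fil_le f1.
- by apply: mspanN; exact: filM.
- exact: gr_nilp_fil.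
apply: gr_nilpN; rewrite mulr_sumr; apply: gr_nilp_sum => i ia.
  by apply: filM.
have iab : (i <= a + b)%N by rewrite -ltnS.
have nia : (i != a :> nat) by [].
have [ai|ai] := ltnP a i.
  have -> : x a * y b * (x i * y (a + b - i)%N) =
            (x a * y (a + b - i)%N) * (x i * y b) by ring.
  rewrite (_ : (a + b + (a + b)) = (a + (a + b - i)) + (i + b))%N; last by lia.
  by apply: gr_nilpM; [exact: filM | apply: IH; lia].
have -> : x a * y b * (x i * y (a + b - i)%N) =
          (x i * y b) * (x a * y (a + b - i)%N) by ring.
rewrite (_ : (a + b + (a + b)) = (i + b) + (a + (a + b - i)))%N; last by lia.
by apply: gr_nilpM; [exact: filM | apply: IH; lia].
Qed.

End Fixed.
End WeightedFiltration.

(** * Upper bound for the growth of the weight spaces *)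

Section GrowthUpperBound.
Local Open Scope ring_scope.
Context {k : fieldType} {N : nat} {T : Type} (ev : T -> 'I_N -> k).

Lemma mspan_empty (P : multinom N -> Prop) (phi : T -> k) :
  (forall m, ~ P m) -> mspan ev P phi -> phi = 0.
Proof.
move=> h [q Pq ->]; rewrite (@evalfE _ _ _ ev q [::]) ?big_nil // => m /Pq.
by move/h.
Qed.

(** The matrix of coefficients has free rows, even if the monomials of [s] are dependent as
    functions, so it has at most as many rows as columns. *)
Lemma mspan_dim (s : seq (multinom N)) (J : finType) (Phi : J -> T -> k) :
  (forall j, mspan ev (fun m => m \in s) (Phi j)) ->
  (forall c : J -> k, \sum_j cst (c j) * Phi j = 0 -> forall j, c j = 0) ->
  (#|J| <= size s)%N.
Proof.
move=> /fin_all_exists2[q qs Phiq] indep.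
apply: leq_trans (size_undup s).
set u := undup s; pose A : 'M[k]_(#|J|, size u) :=
  \matrix_(i, j) mcoeff (nth (@mnm0 N) u j) (q (enum_val i)).
suff /eqP <- : row_free A by exact: rank_leq_col.
apply: inj_row_free => v vA; apply/rowP => i; rewrite !mxE.
rewrite -[i]enum_valK; apply: (indep (fun j => v 0 (enum_rank j))).
have e j : Phi j = \sum_(l < size u)
    cst (mcoeff (nth (@mnm0 N) u l) (q j)) * mon ev (nth (@mnm0 N) u l).
  rewrite Phiq (evalfE ev (q := q j) (undup_uniq s)); last by move=> m /qs; rewrite mem_undup.
  by rewrite (big_nth (@mnm0 N)) big_mkord.
under eq_bigr => j _ do rewrite e mulr_sumr.
rewrite exchange_big big1 //= => l _.
have /matrixP/(_ 0 l) := vA; rewrite !mxE => h.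
transitivity (cst (\sum_j v 0 (enum_rank j) * mcoeff (nth (@mnm0 N) u l) (q j))
   * mon ev (nth (@mnm0 N) u l)).
  rewrite [cst (\sum_j _)](_ : _ = \sum_j (cst (v 0 (enum_rank j)) *
    cst (mcoeff (nth (@mnm0 N) u l) (q j)))); last by rewrite fct_sumE.
  by rewrite mulr_suml; apply: eq_bigr => j _; rewrite mulrA.
rewrite (reindex (@enum_val J predT)) /=; last exact/onW_bij/enum_val_bij.
under eq_bigr => j _ do rewrite enum_valK.
rewrite [X in cst X](_ : _ = 0) ?[LHS]mul0r // -[RHS]h.
by apply: eq_bigr => j _; rewrite mxE.
Qed.

(** An exponent vector is recovered from the set of its large positions, its truncation at [n0] and
    its large values except the first; the weight determines that one, which saves a factor
    [w.+1]. *)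
Lemma card_weight_large_exponents (wt : 'I_N -> nat) (n0 d w : nat) :
  (forall i, 0 < wt i)%N ->
  (#|[set f : {ffun 'I_N -> 'I_w.+1} | (\sum_i wt i * f i == w)%N &
      (#|[set i | n0 <= f i]| <= d)%N]| <=
   2 ^ N * n0.+1 ^ N * w.+1 ^ d.-1)%N.
Proof.
move=> wt0; pose S (f : {ffun 'I_N -> 'I_w.+1}) := [set i | (n0 <= f i)%N].
pose h f := (S f, [ffun i => inord (minn (f i) n0) : 'I_n0.+1],
  [ffun j : 'I_d.-1 => nth (ord0 : 'I_w.+1) [seq f i | i <- behead (enum (S f))] j]).
set G := [set f | _ & _].
have -> : (2 ^ N * n0.+1 ^ N * w.+1 ^ d.-1 =
   #|{: {set 'I_N} * {ffun 'I_N -> 'I_n0.+1} * {ffun 'I_d.-1 -> 'I_w.+1}}|)%N.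
  by rewrite !card_prod !card_ffun !card_ord -[#|_|]cardsT -powersetT card_powerset cardsT card_ord.
rewrite -(card_in_imset (f := h)) ?max_card //.
move=> f g; rewrite !inE => /andP[/eqP wf df] /andP[/eqP wg dg] [eS emin enth].
have out i : i \notin S f -> f i = g i.
  move=> iS; have jS : i \notin S g by rewrite -eS.
  move: iS jS; rewrite !inE -!ltnNge => fi gi.
  have /ffunP/(_ i) := emin; rewrite !ffunE => /(congr1 val).
  rewrite /= !inordK ?ltnS ?geq_minr // => /= eq.
  by apply: val_inj; move: eq; rewrite (minn_idPl (ltnW fi)) (minn_idPl (ltnW gi)).
have inb i : i \in behead (enum (S f)) -> f i = g i.
  move=> iS; set b := behead _ in iS enth.
  have szb : (size b <= d.-1)%N by rewrite size_behead -cardE -!subn1 leq_sub2r.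
  have lt : (index i b < d.-1)%N by apply: leq_trans szb; rewrite index_mem.
  have /ffunP/(_ (Ordinal lt)) := enth; rewrite !ffunE /= -eS.
  by rewrite !(nth_map i) ?index_mem // nth_index.
apply/ffunP => i; have [iS|/out//] := boolP (i \in S f).
have := iS; rewrite -mem_enum; case eb : (enum (S f)) inb => [//|i0 b] /= inb.
rewrite inE => /orP[/eqP{iS}->|/inb//].
have others j : j != i0 -> f j = g j.
  move=> j0; have [jS|/out//] := boolP (j \in S f).
  by apply: inb; move: jS; rewrite -mem_enum eb inE (negbTE j0).
(* The vectors agree away from [i0], and [wt i0] is positive, so equal weights force equality at
   [i0]. *)
move: (etrans wf (esym wg)); rewrite (bigD1 i0) //= [in RHS](bigD1 i0) //=.
under eq_bigr => j j0 do rewrite others //.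
by move/addIn/eqP; rewrite eqn_pmul2l // => /eqP/val_inj.
Qed.

Variables (wt : 'I_N -> nat) (U : {pred 'I_N}) (rk : 'I_N -> nat) (c R d : nat).
Hypothesis wt_gt0 : forall i, (0 < wt i)%N.
Hypothesis rk_le : forall i, (rk i <= R)%N.
Local Notation F := (fil ev wt predT (fun=> 1%N)).
Local Notation Fil := (fil ev wt U rk).
Hypothesis coord_fil : forall i, exists u : T -> k,
  [/\ F 1 (wt i) u, Fil c (wt i) u & F 2 (wt i) (coordf ev i - u)].

(** Modulo higher degree, a monomial of degree [j] is a product of [j] linear parts [u], each of
    rank at least [c]. Corrections raise the degree, and the process stops because the degree cannot
    exceed the weight. *)
Lemma fil_deg_fil j w phi : F j w phi -> Fil (c * j) w phi.
Proof.
suff h n : forall j w phi, (w < j + n)%N -> F j w phi -> Fil (c * j) w phi.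
  by apply: (h w.+1); rewrite addnS ltnS leq_addl.
elim: n => {j w phi} [|n IH] j w phi hw.
  move=> /mspan_empty ->; first exact: mspan0.
  move=> m [_ jm wm]; move: hw; rewrite addn0 -wm ltnNge => /negP; apply.
  apply: leq_trans jm _; apply: leq_sum => i _.
  by rewrite leq_mul2r wt_gt0 orbT.
apply: mspan_bind => m [_ jm wm].
(* [Q] asserts a leading part of the expected rank. It is multiplicative, hence passes from the
   coordinates to all monomials. *)
pose Q d v psi := exists u, [/\ F d v u, Fil (c * d) v u & F d.+1 v (psi - u)].
have QM d1 v1 p1 d2 v2 p2 : Q d1 v1 p1 -> Q d2 v2 p2 ->
    Q (d1 + d2)%N (v1 + v2)%N (p1 * p2).
  move=> [u1 [a1 b1 c1]] [u2 [a2 b2 c2]]; exists (u1 * u2); split.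
  - exact: filM.
  - by rewrite mulnDr; exact: filM.
  have -> : p1 * p2 - u1 * u2 = (p1 - u1) * p2 + u1 * (p2 - u2) by ring.
  have f2 : F d2 v2 p2.
    by rewrite -(subrK u2 p2); apply: mspanD => //; exact: fil_le c2.
  apply: mspanD; first by rewrite -addSn; exact: filM.
  by rewrite -addnS; exact: filM.
have Q1 : Q 0%N 0%N 1.
  by exists 1; rewrite muln0 subrr; split; [exact: fil1|exact: fil1|exact: mspan0].
have QX d1 v1 p1 e : Q d1 v1 p1 -> Q (d1 * e)%N (v1 * e)%N (p1 ^+ e).
  move=> q1; elim: e => [|e IHe]; first by rewrite !muln0.
  by rewrite exprS !mulnS; exact: QM.
have : Q (mstat (fun=> 1%N) m) (mstat wt m) (mon ev m).
  rewrite mon_prod /mstat.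
  elim/big_rec3: _ => // i d1 v1 p1 _; apply: QM; apply: QX.
  by have [u [? ? ?]] := coord_fil i; exists u; rewrite muln1.
move=> [u [_ b1 c1]]; rewrite -[mon ev m](subrK u) addrC -wm; apply: mspanD.
  by apply: fil_le b1; rewrite leq_mul2l jm orbT.
have := IH (mstat (fun=> 1%N) m).+1 (mstat wt m) _ _ c1.
move=> h; apply: fil_le (h _); last by rewrite wm; lia.
by rewrite leq_mul2l; lia.
Qed.

Variable bad : rel 'I_N.
Hypothesis badP : forall i j, bad i j -> [/\ U i, U j, i != j &
  gr_nilp ev wt U rk (rk i + rk j) (wt i + wt j) (coordf ev i * coordf ev j)].

Definition reduced n0 w (m : multinom N) :=
  [/\ supported U m, mstat wt m = w &
      forall i j, bad i j -> (n0 <= m i)%N -> (n0 <= m j)%N -> False].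

(** If both exponents of a bad pair are large, the monomial contains a power of their product that
    lies in higher rank, so it can be rewritten with larger rank. In weight [w] the rank is at most
    [R * w], so the rewriting ends. *)
Lemma fil_reduced : exists n0, forall w phi, F 0 w phi -> mspan ev (reduced n0 w) phi.
Proof.
have : forall p : 'I_N * 'I_N, exists n0, forall n, (n0 <= n)%N -> bad p.1 p.2 ->
    Fil (n * (rk p.1 + rk p.2) + 1) (n * (wt p.1 + wt p.2))
      ((coordf ev p.1 * coordf ev p.2) ^+ n).
  move=> [i j] /=; have [b|] := boolP (bad i j); last by exists 0%N.
  have [Ui Uj _ nil] := badP b.
  have f : Fil (rk i + rk j) (wt i + wt j) (coordf ev i * coordf ev j).
    by apply: filM; exact: fil_coord.
  by have [n0 h] := gr_nilp_exp f nil; exists n0 => n /h.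
move=> /fin_all_exists[n1 hn1].
exists (\max_p n1 p) => w phi.
set n0 := \max_p n1 p.
have {}hn1 i j : bad i j -> Fil (n0 * (rk i + rk j) + 1) (n0 * (wt i + wt j))
      ((coordf ev i * coordf ev j) ^+ n0).
  by apply: (hn1 (i, j)); exact: (leq_bigmax (i, j)).
suff h n r : (R * w < r + n)%N -> forall phi, Fil r w phi -> mspan ev (reduced n0 w) phi.
  move=> /fil_deg_fil; rewrite muln0; apply: (h (R * w).+1).
  by rewrite addnS ltnS leq_addl.
elim: n r => [|n IH] r hr {}phi.
  move=> /mspan_empty ->; first exact: mspan0.
  move=> m [_ rm wm]; move: hr; rewrite addn0 -wm ltnNge => /negP; apply.
  apply: leq_trans rm _; rewrite /mstat big_distrr; apply: leq_sum => i _ /=.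
  rewrite mulnA leq_mul2r; apply/orP; right; apply: leq_trans (rk_le i) _.
  by rewrite leq_pmulr.
apply: mspan_bind => m [sm rm wm].
have [good|] := pselect (reduced n0 w m); first exact: mspan_mon.
have [[[i j] /= b /andP[mi mj]]|nb] := pselect (exists2 p : 'I_N * 'I_N, bad p.1 p.2 &
    (n0 <= m p.1)%N && (n0 <= m p.2)%N); last first.
  case; split=> // i j b mi mj; apply: nb; exists (i, j) => //=.
  by rewrite mi.
move=> _; have [Ui Uj nij _] := badP b.
pose l := mnm_muln (mnm_add (mnm1 i) (mnm1 j)) n0.
have lm : mpoly.lem l m.
  apply/mnm_lepP => a; rewrite mulmnE mnmDE !mnm1E.
  case: (eqVneq i a) => [<-|_]; first by rewrite eq_sym (negbTE nij) mul1n.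
  by case: (eqVneq j a) => [<-|_]; rewrite ?mul1n ?mul0n.
have em := submK lm; set m' := mnm_sub m l in em.
have monl : mon ev l = (coordf ev i * coordf ev j) ^+ n0.
  rewrite -!mon1 -monD; rewrite /l; elim: (n0) => [|e IHe].
    by rewrite mulm0n mon0 expr0.
  by rewrite mulmS monD IHe exprS.
have statl f : mstat f l = (n0 * (f i + f j))%N.
  rewrite /l; elim: (n0) => [|e IHe]; first by rewrite mulm0n mstat0.
  by rewrite mulmS !mstatD !mstat1 IHe mulSn.
apply: (IH r.+1); first by rewrite addSnnS.
have : Fil (mstat rk m + 1) (mstat wt m) (mon ev m).
  rewrite -em monD monl !mstatD !statl -addnA; apply: filM; last exact: hn1.
  apply: fil_mon => // a; rewrite mnmBE => h; apply: sm.
  by apply: leq_trans h _; rewrite leq_subr.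
by rewrite wm; apply: fil_le; rewrite addn1 ltnS.
Qed.

Hypothesis card_indep : forall S : {set 'I_N}, {subset S <= U} ->
  (forall i j, i \in S -> j \in S -> ~~ bad i j) -> (#|S| <= d)%N.

(** The positions of large exponents in a reduced monomial contain no bad pair, so there are at most
    [d] of them, and the count of exponent vectors applies. *)
Lemma growth_upper_bound : exists C, forall w (J : finType) (Phi : J -> T -> k),
  (forall j, F 0 w (Phi j)) ->
  (forall c : J -> k, \sum_j cst (c j) * Phi j = 0 -> forall j, c j = 0) ->
  (#|J| <= C * w.+1 ^ d.-1)%N.
Proof.
have [n0 hn0] := fil_reduced.
exists (2 ^ N * n0.+2 ^ N)%N => w J Phi hPhi indep.
pose to_m (f : {ffun 'I_N -> 'I_w.+1}) := Multinom [tuple (f i : nat) | i < N].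
have to_mE f i : to_m f i = f i by rewrite /to_m multinomE tnth_mktuple.
(* The threshold is [n0.+1] so that a large exponent is positive even if [n0 = 0], which puts its
   position in [U]. *)
pose G := [set f : {ffun 'I_N -> 'I_w.+1} | (\sum_i wt i * f i == w)%N &
      (#|[set i | n0.+1 <= f i]| <= d)%N].
have leG : (#|J| <= #|G|)%N.
  rewrite cardE -(size_map to_m); apply: (mspan_dim (Phi := Phi)) => // j.
  apply: mspan_sub (hn0 _ _ (hPhi j)) => m [sm wm rm].
  have mw i : (m i < w.+1)%N.
    rewrite ltnS -wm /mstat (bigD1 i) //=; apply: leq_trans (leq_addr _ _).
    by rewrite leq_pmull.
  pose f := [ffun i => Ordinal (mw i)].
  have em : m = to_m f by apply/mnmP => i; rewrite to_mE ffunE.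
  rewrite em; apply: map_f; rewrite mem_enum inE; apply/andP; split.
    by apply/eqP; rewrite -[RHS]wm; apply: eq_bigr => i _; rewrite ffunE.
  apply: card_indep => [i|i i']; rewrite !inE !ffunE /=.
    by move=> h; apply: sm; exact: leq_ltn_trans h.
  move=> mi mj; apply/negP => b; apply: (rm _ _ b); exact: ltnW.
exact: leq_trans leG (card_weight_large_exponents _ _ _ wt_gt0).
Qed.

End GrowthUpperBound.

(** * Lower bound for the growth, from a chain of sets with homogeneous prime vanishing ideals *)

Section ChainGrowth.
Local Open Scope ring_scope.
Local Open Scope classical_set_scope.
Context {k : fieldType} {N : nat} {T : Type} (ev : T -> 'I_N -> k).
Variable wt : 'I_N -> nat.
Local Notation Hom := (fil ev wt predT (fun=> 1%N) 0).

Definition vanishes_on (W : set T) (phi : T -> k) := forall x, W x -> phi x = 0.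

Variables (W : nat -> set T) (n : nat).
Hypothesis W0 : W 0%N !=set0.
Hypothesis Wsub : forall i, (i < n)%N -> W i `<=` W i.+1.
Hypothesis Wprime : forall i, (i <= n)%N -> forall w w' phi psi,
  Hom w phi -> Hom w' psi -> vanishes_on (W i) (phi * psi) ->
  vanishes_on (W i) phi \/ vanishes_on (W i) psi.
Hypothesis Wsep : forall i, (i < n)%N -> exists w phi,
  [/\ Hom w phi, vanishes_on (W i) phi & ~ vanishes_on (W i.+1) phi].
Hypothesis Wpos : exists w phi, [/\ (0 < w)%N, Hom w phi & ~ vanishes_on (W 0%N) phi].

Lemma not_vanishes_exp V phi e :
  ~ vanishes_on V phi -> ~ vanishes_on V (phi ^+ e).
Proof.
move=> /existsNP[x /not_implyP[Vx /eqP px]] /(_ x Vx); rewrite exprfctE => /eqP.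
by rewrite (negbTE (expf_neq0 _ px)).
Qed.

Lemma not_vanishes_sub V V' phi : V `<=` V' ->
  ~ vanishes_on V phi -> ~ vanishes_on V' phi.
Proof. by move=> sub h h'; apply: h => x /sub /h'. Qed.

Lemma chain_sub0 i : (i <= n)%N -> W 0%N `<=` W i.
Proof.
elim: i => [_ x //|i IH hi x W0x]; exact: (Wsub hi (IH (ltnW hi) x W0x)).
Qed.

(* If f vanishes on W_m but not on W_(m+1), the products f^i g^(M-i) Phi_j, where the
   Phi_j are independent on W_m and g does not vanish on W_0, are independent on
   W_(m+1); suitable powers of f and g make all the weights equal. *)
Lemma chain_indep m : (m <= n)%N -> exists E, forall M, exists (J : finType) (Phi : J -> T -> k),
  [/\ #|J| = (M ^ m)%N, forall j, Hom (M * E) (Phi j) &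
      forall c : J -> k, vanishes_on (W m) (\sum_j cst (c j) * Phi j) ->
        forall j, c j = 0].
Proof.
elim: m => [|m IH] hm.
  exists 0%N => M; exists unit, (fun=> 1); split=> [|_|c].
  - by rewrite card_unit.
  - by rewrite muln0; exact: fil1.
  have [x Wx] := W0; move=> /(_ x Wx) + []; rewrite fct_sumE (bigD1 tt) //= big1.
    by rewrite addr0 [_ x]mulr1.
  by move=> [].
have [E hE] := IH (ltnW hm).
have [em [f0 [hf0 f0W f0N]]] := Wsep hm.
have [e0 [g0 [e0_gt0 hg0 g0N]]] := Wpos.
(* Both powers have weight [e]. Since [e0] is positive, [f] still vanishes on [W m]. *)
pose f := f0 ^+ e0; pose g := g0 ^+ em; pose e := (e0 * em)%N.
have hf i : Hom (e * i) (f ^+ i).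
  by rewrite mulnC; have := filX i (filX e0 hf0); rewrite !muln0.
have hg i : Hom (e * i) (g ^+ i).
  by rewrite mulnC; have := filX i (filX em hg0); rewrite !muln0 (mulnC em).
have fN i : ~ vanishes_on (W m.+1) (f ^+ i) by do 2 apply: not_vanishes_exp.
have gN i : ~ vanishes_on (W m) (g ^+ i).
  by do 2 apply: not_vanishes_exp; apply: not_vanishes_sub g0N; exact/chain_sub0/ltnW.
have fW x : W m x -> f x = 0.
  by move=> /f0W h; rewrite /f exprfctE h expr0n -leqn0 leqNgt e0_gt0.
exists (E + e)%N => M; have [J [Phi [cJ hPhi indep]]] := hE M.
exists ('I_M * J : finType)%type, (fun p : 'I_M * J => f ^+ p.1 * g ^+ (M - p.1) * Phi p.2); split.
- by rewrite card_prod card_ord cJ expnS.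
- move=> [i j] /=; rewrite mulnDr addnC -{1}(subnKC (ltnW (ltn_ord i))).
  rewrite (mulnC _ e) mulnDr; apply: (@filM _ _ _ _ _ _ _ 0 _ 0) => //.
  exact: (@filM _ _ _ _ _ _ _ 0 _ 0).
move=> c hc.
suff h i : forall (i' : 'I_M) j, i' = i :> nat -> c (i', j) = 0 by move=> [i j]; exact: h.
elim/ltn_ind: i => i IHi i' j ei'.
(* By induction the terms with lower powers of [f] have zero coefficients. Primality allows division
   of the relation by [f ^+ i] on [W m.+1]; restricting the quotient to [W m] leaves only the terms
   with first index [i]. *)
pose rest := \sum_(p : 'I_M * J | (i <= p.1)%N)
  cst (c p) * (f ^+ (p.1 - i) * g ^+ (M - p.1) * Phi p.2).
have iM : (i <= M)%N by rewrite -ei' ltnW.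
have hrest : Hom (e * (M - i) + M * E) rest.
  apply: mspan_sum => p ip; apply: mspanZ.
  apply: (@filM _ _ _ _ _ _ _ 0 _ 0) => //.
  rewrite (_ : e * (M - i) = e * (p.1 - i) + e * (M - p.1))%N.
    exact: (@filM _ _ _ _ _ _ _ 0 _ 0).
  by rewrite -mulnDr addnC addnBA // subnK // ltnW.
have sum_rest : \sum_p cst (c p) * (f ^+ p.1 * g ^+ (M - p.1) * Phi p.2) = f ^+ i * rest.
  rewrite (bigID (fun p : 'I_M * J => (i <= p.1)%N)) /= [X in _ + X]big1 ?addr0.
    rewrite /rest mulr_sumr; apply: eq_bigr => p ip.
    by rewrite -{1}(subnKC ip) exprD; ring.
  by move=> [a b] /=; rewrite -ltnNge => ai; rewrite (IHi a) // [LHS]mul0r.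
have restW : vanishes_on (W m.+1) rest.
  by move: hc; rewrite sum_rest => /(Wprime hm (hf i) hrest)[/fN|].
have restWm : vanishes_on (W m) (g ^+ (M - i) * \sum_j cst (c (i', j)) * Phi j).
  move=> x Wx; have := restW _ (Wsub hm Wx); rewrite /rest fct_sumE => <-.
  rewrite (bigID (fun p : 'I_M * J => p.1 == i')) /= [X in _ = _ + X]big1 ?addr0.
    rewrite mulr_sumr fct_sumE.
    rewrite (reindex (fun j => (i', j))) /=; last first.
      by exists snd => [b _ //|[a b]]; rewrite inE /= => /andP[_ /eqP ->].
    apply: eq_big => [b|b _]; first by rewrite ei' leqnn eqxx.
    rewrite ei' subnn expr0 mul1r.
    by rewrite -[LHS]/((_ * (_ * _)) x) -[RHS]/((_ * (_ * _)) x); congr (_ x); ring.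
  move=> [a b] /= /andP[ia nai].
  have {}ia : (i < a)%N.
    by rewrite ltn_neqAle ia andbT eq_sym; apply: contra nai => /eqP e1; apply/eqP/val_inj; rewrite /= e1.
  rewrite -[LHS]/(c (a, b) * ((f ^+ (a - i)) x * (g ^+ (M - a)) x * Phi b x)).
  by rewrite exprfctE (fW _ Wx) expr0n subn_eq0 leqNgt ia !mul0r mulr0.
have hsum : Hom (M * E) (\sum_j cst (c (i', j)) * Phi j).
  by apply: mspan_sum => b _; apply: mspanZ; exact: hPhi.
have [/gN//|] := Wprime (ltnW hm) (hg _) hsum restWm.
by move=> /indep.
Qed.

(** The chain supplies [M ^ n] independent functions of weight [M * E] for every [M], so the growth
    exponent is at least [n]. *)
Lemma chain_length_le C D :
  (forall w (J : finType) (Phi : J -> T -> k), (forall j, Hom w (Phi j)) ->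
     (forall c : J -> k, \sum_j cst (c j) * Phi j = 0 -> forall j, c j = 0) ->
     (#|J| <= C * w.+1 ^ D)%N) ->
  (n <= D)%N.
Proof.
move=> up; have [E hE] := chain_indep (leqnn n).
rewrite leqNgt; apply/negP => Dn.
(* As [(M * E).+1 <= M * E.+1], the upper bound is at most [C * E.+1 ^ D * M ^ D], which is less
   than [M ^ D.+1] for this [M]. *)
pose M := (C * E.+1 ^ D).+1.
have [J [Phi [cJ hPhi indep]]] := hE M.
have : (M ^ n <= C * (M * E).+1 ^ D)%N.
  by rewrite -cJ; apply: up hPhi _ => c hc; apply: indep => x _; rewrite hc.
rewrite leqNgt => /negP; apply.
apply: (@leq_ltn_trans (C * (M * E.+1) ^ D)).
  rewrite leq_mul2l; apply/orP; right; elim: (D) => // D' IH.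
  by rewrite !expnS leq_mul // mulnS; lia.
apply: (@leq_trans (M ^ D.+1)); last exact: leq_pexp2l.
by rewrite expnMn mulnCA expnS (mulnC M) ltn_pmul2l ?expn_gt0.
Qed.

End ChainGrowth.

Definition coordinates (k : fieldType) (n : nat) (T : Type) (pt : T -> affine k n)
  (x : T) (i : 'I_n) : k := tnth (pt x) i.

(** * The action of the multiplicative group on the coefficients *)

Section GmAction.
Local Open Scope ring_scope.
Local Open Scope classical_set_scope.
Context {k : fieldType} (tau : nat).
Local Notation space := (affine k (size (coeffs tau))).
Implicit Types (x : space) (c : k).

Lemma weight_gt0 i : (0 < weight (tau := tau) i)%N.
Proof.
rewrite /weight; have := mem_tnth i (in_tuple (coeffs tau)).
rewrite [X in _ \in X]/= mem_filter => /andP[_ /allpairsPdep[p [r [_ hr ->]]]].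
by move: hr; rewrite mem_filter mem_iota => /and3P[].
Qed.

Lemma coeff_gm_act c x d : coeff (gm_act c x) d = c ^+ d.2 * coeff x d.
Proof.
rewrite /coeff; have [dS|dS] := boolP (d \in coeffs tau); last first.
  by rewrite !nth_default ?mulr0 // size_tuple leqNgt index_mem.
have lt : (index d (coeffs tau) < size (coeffs tau))%N by rewrite index_mem.
rewrite -[index d _]/(nat_of_ord (Ordinal lt)) -!tnth_nth tnth_mktuple.
by rewrite /weight (tnth_nth d) /= nth_index.
Qed.

(** The weight of a coefficient is the exponent of its term, so the action substitutes [c *: 'X] for
    the variable. This is a ring morphism, hence preserves the five identities. *)
Lemma partial_poly_gm_act c x s i j :
  partial_poly (gm_act c x) s i j = partial_poly x s i j \Po (c *: 'X).
Proof.
rewrite /partial_poly raddf_sum; apply: eq_bigr => r _ /=.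
by rewrite coeff_gm_act comp_polyZ comp_Xn_poly exprZn scalerA mulrC.
Qed.

Lemma full_poly_gm_act c x s i :
  full_poly (gm_act c x) s i = full_poly x s i \Po (c *: 'X).
Proof.
rewrite /full_poly raddf_sum; apply: eq_bigr => p _ /=.
exact: partial_poly_gm_act.
Qed.

Lemma gm_act_equations c x : equations x -> equations (gm_act c x).
Proof.
rewrite /equations !full_poly_gm_act !partial_poly_gm_act => -[h1 h2 h3 h4 h5].
have compN p : (- p) \Po (c *: 'X) = - (p \Po (c *: 'X)) by rewrite raddfN.
by split; [move: h1|move: h2|move: h3|move: h4|move: h5];
  move=> /(congr1 (comp_poly (c *: 'X))); rewrite !(comp_polyD, compN, comp_polyM).
Qed.

End GmAction.

(** * From the topology of the orbit space to weighted homogeneous functions *)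

Section OrbitSpace.
Local Open Scope ring_scope.
Local Open Scope classical_set_scope.
Local Open Scope quotient_scope.
Context {k : closedFieldType} (tau : nat).
Local Notation space := (affine k (size (coeffs tau))).
Local Notation T := (punctured_variety (k := k) (tau := tau)).
Local Notation M := (moduli_space k tau).

Local Notation evT := (coordinates (set_val : T -> space)).

Local Notation Hom := (fil evT (weight (tau := tau)) predT (fun=> 1%N) 0).

Lemma gm_act_punctured (c : k) (x : T) : c != 0 ->
  exists y : T, set_val y = gm_act c (set_val x).
Proof.
move=> c0; have [v nv] : T (set_val x) by exact: set_valP.
have h : T (gm_act c (set_val x)).
  split; first exact: gm_act_equations.
  move=> e; apply: nv; rewrite /origin; apply: eq_from_tnth => i.
  have /(congr1 (fun y => tnth y i)) := e; rewrite !tnth_mktuple.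
  by move/eqP; rewrite mulf_eq0 expf_eq0 (negbTE c0) andbF => /eqP.
by exists (SigSub (mem_set h)).
Qed.

Lemma pi_eqP (x y : T) : \pi_M x = \pi_M y <->
  exists2 c : k, c != 0 & set_val y = gm_act c (set_val x).
Proof.
split=> [/eqmodP/asboolP //|h].
by apply/eqmodP/asboolP.
Qed.

Lemma coordinates_gm_act c (x y : T) i : set_val y = gm_act c (set_val x) ->
  evT y i = c ^+ weight i * evT x i.
Proof. by rewrite /coordinates => ->; rewrite tnth_mktuple. Qed.

Lemma mon_gm_act c (x y : T) m : set_val y = gm_act c (set_val x) ->
  mon evT m y = c ^+ mstat (weight (tau := tau)) m * mon evT m x.
Proof.
move=> e; rewrite mon_prod !fct_prodE /mstat.
rewrite -prodrXr -big_split; apply: eq_bigr => i _ /=.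
by rewrite !exprfctE /coordf (coordinates_gm_act _ e) exprMn exprM.
Qed.

Lemma evalf_gm_act c (x y : T) w (q : mpoly (size (coeffs tau)) k) :
  set_val y = gm_act c (set_val x) ->
  (forall m, m \in msupp q -> mstat (weight (tau := tau)) m = w) ->
  evalf evT q y = c ^+ w * evalf evT q x.
Proof.
move=> e h; rewrite !(evalfE _ (msupp_uniq q)) // !fct_sumE mulr_sumr.
rewrite big_seq [RHS]big_seq; apply: eq_bigr => m /h <-.
by rewrite mulrCA -(mon_gm_act _ e).
Qed.

Lemma hom_gm_act c (x y : T) w phi : set_val y = gm_act c (set_val x) ->
  Hom w phi -> phi y = c ^+ w * phi x.
Proof. by move=> e [q h ->]; apply: evalf_gm_act e _ => m /h[]. Qed.

(** The zeros of a weighted homogeneous function form a union of orbits, so they can be tested on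
    the chosen representatives. *)
Lemma hom_repr (x : T) w phi : Hom w phi -> (phi (repr (\pi_M x)) == 0) = (phi x == 0).
Proof.
move=> h; have /pi_eqP[c c0 e] : \pi_M x = \pi_M (repr (\pi_M x)) by rewrite reprK.
by rewrite (hom_gm_act e h) mulf_eq0 expf_eq0 (negbTE c0) andbF.
Qed.

Lemma closed_hom_zeros w phi : Hom w phi -> closed [set z : M | phi (repr z) = 0].
Proof.
move=> h; rewrite -openC; rewrite /open /= /quotient_open.
case: (h) => q _ eq; exists (~` zero_locus [set q]).
  by exists [set q]; rewrite setCK.
apply/seteqP; split=> x /=.
  move=> nz /eqP; rewrite (hom_repr _ h) => /eqP e0; apply: nz => p ->.
  by move: e0; rewrite eq.
move=> nz e0; apply: nz; apply/eqP; rewrite (hom_repr _ h); apply/eqP.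
by rewrite eq; exact: (e0 q).
Qed.

(** For nonzero [q] the polynomial ['X * q + 1] is not constant, hence has a root in the closed
    field; but its value is 1 at 0 and, by hypothesis on [q], at every unit. *)
Lemma poly_zero_units (q : {poly k}) : (forall c, c != 0 -> q.[c] = 0) -> q = 0.
Proof.
move=> h; apply/eqP; apply: contraT => q0.
have : size ('X * q + 1) != 1%N.
  by rewrite mulrC -[1]/(1%:P) size_MXaddC (negbTE q0) /= eqSS size_poly_eq0.
move=> /closed_rootP[c]; rewrite /root !hornerE; have [->|c0] := eqVneq c 0.
  by rewrite mul0r add0r oner_eq0.
by rewrite h // mulr0 add0r oner_eq0.
Qed.

Definition weight_part w (p : mpoly (size (coeffs tau)) k) :=
  \sum_(m <- msupp p | mstat (weight (tau := tau)) m == w) mcoeff m p *: mpolyX k m.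

Lemma weight_part_hom w p : Hom w (evalf evT (weight_part w p)).
Proof.
rewrite /weight_part (big_morph _ (evalfD evT) (evalf0 evT)).
apply: mspan_sum => m /eqP <-; rewrite evalfZ; apply: mspanZ.
by apply: mspan_mon; split.
Qed.

Lemma evalf_weight_part p B : (forall m, m \in msupp p -> mstat (weight (tau := tau)) m < B)%N ->
  evalf evT p = \sum_(w < B) evalf evT (weight_part w p).
Proof.
move=> hB; rewrite {1}(mpolyE p) -(big_morph _ (evalfD evT) (evalf0 evT)).
congr evalf; rewrite /weight_part (exchange_big_dep predT) //=.
rewrite big_seq [RHS]big_seq; apply: eq_bigr => m /hB lt.
by rewrite (bigD1 (Ordinal lt)) //= big1 ?addr0 // => i /andP[/eqP e]; rewrite -val_eqE /= e eqxx.
Qed.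

(** Along the orbit of [x], [p] is a polynomial in [c] whose coefficients are the values at [x] of
    the weight parts; it vanishes at all units, hence identically. *)
Lemma vanishing_weight_part (x : T) p w :
  (forall c (y : T), c != 0 -> set_val y = gm_act c (set_val x) -> evalf evT p y = 0) ->
  evalf evT (weight_part w p) x = 0.
Proof.
(* Adding [w] keeps the index [w] below [B] even if [w] exceeds all weights in [p]. *)
move=> h; pose B := (\max_(m <- msupp p) mstat (weight (tau := tau)) m + w).+1.
have hB m : m \in msupp p -> (mstat (weight (tau := tau)) m < B)%N.
  by move=> mp; rewrite ltnS; apply: leq_trans (leq_addr _ _); exact: leq_bigmax_seq.
pose q := \poly_(v < B) evalf evT (weight_part v p) x.
have q0 : q = 0.
  apply: poly_zero_units => c c0; have [y ey] := gm_act_punctured x c0.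
  rewrite -(h c y c0 ey) (evalf_weight_part hB) fct_sumE horner_poly.
  by apply: eq_bigr => v _; rewrite (hom_gm_act ey (weight_part_hom v p)) mulrC.
have : q`_w = 0 by rewrite q0 coef0.
by rewrite coef_poly ltnS leq_addl.
Qed.

(** The preimages of the closed sets satisfy the hypotheses on chains: irreducibility gives
    primality for homogeneous functions, since their zero sets are closed in the quotient. *)
Lemma moduli_dim_le D :
  (exists C, forall w (J : finType) (Phi : J -> T -> k), (forall j, Hom w (Phi j)) ->
     (forall c : J -> k, \sum_j cst (c j) * Phi j = 0 -> forall j, c j = 0) ->
     (#|J| <= C * w.+1 ^ D)%N) ->
  dim_le M D.
Proof.
move=> [C up] n Z Zirr Zsub.
pose W i : set T := \pi_M @^-1` Z i.
have ne i : (i <= n)%N -> W i !=set0.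
  by move=> /Zirr[_ [[z Zz] _]]; exists (repr z); rewrite /W /= reprK.
apply: (@chain_length_le _ _ _ evT (weight (tau := tau)) W n _ _ _ _ _ C) => //.
- exact: ne.
- by move=> i /Zsub[sub _] x; exact: sub.
- move=> i hi w w' phi psi hphi hpsi van.
  have [_ [_ irr]] := Zirr i hi.
  have [z Zz|sub|sub] := irr _ _ (closed_hom_zeros hphi) (closed_hom_zeros hpsi).
  + have /eqP : (phi * psi) (repr z) = 0 by apply: van; rewrite /W /= reprK.
    by rewrite mulf_eq0 => /orP[/eqP|/eqP]; [left|right].
  + left=> x Wx; apply/eqP; rewrite -(hom_repr _ hphi); apply/eqP.
    exact: (sub (\pi_M x)).
  + right=> x Wx; apply/eqP; rewrite -(hom_repr _ hpsi); apply/eqP.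
    exact: (sub (\pi_M x)).
(* A point over [Z i.+1] but not over [Z i] is separated from [W i] by a polynomial vanishing there.
   Some weight part is nonzero at the point, and all weight parts vanish on [W i], a union of
   orbits. *)
- move=> i hi; have [sub nsub] := Zsub i hi.
  have [cl _] := Zirr i (ltnW hi).
  have /existsNP[z /not_implyP[Zz nZz]] : ~ (Z i.+1 `<=` Z i) by exact: nsub.
  have [V [S VS] eV] : open (\pi_M @^-1` (~` Z i)) by rewrite -openC in cl; exact: cl.
  have Wz : ~ W i (repr z) by rewrite /W /= reprK.
  have : V (set_val (repr z)) by rewrite -[V _]/((set_val @^-1` V) (repr z)) eV.
  move=> Vz; have : ~ zero_locus S (set_val (repr z)) by rewrite -VS; exact.
  move=> /existsNP[p /not_implyP[Sp pz]].
  have pW x : W i x -> evalf evT p x = 0.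
    move=> Wx; have : zero_locus S (set_val x).
      by rewrite -VS => Vx; have : (set_val @^-1` V) x by []; rewrite eV.
    exact.
  pose B := (\max_(m <- msupp p) mstat (weight (tau := tau)) m).+1.
  have hB m : m \in msupp p -> (mstat (weight (tau := tau)) m < B)%N.
    by move=> mp; rewrite ltnS; exact: leq_bigmax_seq.
  have [w pw] : exists w, evalf evT (weight_part w p) (repr z) != 0.
    apply: contrapT => /forallNP hw; apply: pz.
    rewrite -[LHS]/(evalf evT p (repr z)) (evalf_weight_part hB) fct_sumE big1 // => v _.
    by apply/eqP; have /negP := hw v; rewrite negbK.
  exists w, (evalf evT (weight_part w p)); split; first exact: weight_part_hom.
    move=> x Wx; apply: vanishing_weight_part => c y c0 ey; apply: pW.
    rewrite /W /=; rewrite (_ : \pi_M y = \pi_M x) //; apply/esym/pi_eqP.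
    by exists c.
  move=> /(_ (repr z)); rewrite /W /= reprK => /(_ Zz)/eqP.
  by rewrite (negbTE pw).
(* The origin being removed, some coordinate is nonzero at [x], and coordinates have positive
   weight. *)
have [x Wx] := ne 0%N isT.
have [v nv] : T (set_val x) by exact: set_valP.
have [i xi] : exists i, evT x i != 0.
  apply: contrapT => /forallNP hx; apply: nv; apply: eq_from_tnth => i.
  by rewrite tnth_mktuple; apply/eqP; have /negP := hx i; rewrite negbK.
exists (weight i), (coordf evT i); split; first exact: weight_gt0.
  by apply: fil_le (fil_coord _ _ _ _).
by move=> /(_ x Wx)/eqP; rewrite (negbTE xi).
Qed.

End OrbitSpace.

(* The ranks are chosen so that the three quadratic forms below have one monomial of
   least rank each, without common factors. *)
Definition rank_of (p : letter * nat * nat) : nat :=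
  if p == (Lf, 8, 4)%N then 3 else
  if p \in [:: (Lf, 6, 1); (Lf, 6, 3); (Lf, 10, 2); (Lg, 8, 4); (Lg, 8, 5)]%N then 4
  else 5.

(* (s, i, j, (l, n)) stands for the n coefficients of t^(j + 6 l), t^(j + 6 (l + 1)), ...
   in the partial polynomial of residue j of the letter (s, i). *)
Definition families (tau : nat) : seq (letter * nat * nat * (nat * nat)) :=
  [:: (Lf, 6, 1, (1, tau)); (Lf, 10, 1, (0, tau.+1)); (Lf, 10, 2, (0, tau.+1));
      (Lg, 8, 2, (1, tau)); (Lf, 6, 3, (0, tau.+1)); (Lf, 8, 4, (0, tau.+1));
      (Lg, 8, 4, (0, tau.+1)); (Lg, 8, 5, (0, tau)); (Lg, 8, 6, (0, tau.+1));
      (Lg, 4, 6, (1, tau.-1)); (Lf, 8, 6, (0, tau.+1))]%N.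

Definition family_coeffs (f : letter * nat * nat * (nat * nat)) :=
  [seq (f.1.1, f.1.2 + 6 * n)%N | n <- iota f.2.1 f.2.2].

Definition essential (tau : nat) : seq (letter * nat * nat) := flatten [seq family_coeffs f | f <- families tau].

(** * Coefficients as functions, and the linear parts of the equations *)

Section CoefficientFunctions.
Local Open Scope ring_scope.
Context {k : fieldType} {tau : nat} {T : Type}.
Variable pt : T -> affine k (size (coeffs tau)).

Local Notation N := (size (coeffs tau)).
Definition triple (i : 'I_N) : letter * nat * nat := tnth (in_tuple (coeffs tau)) i.
Local Notation evpt := (coordinates pt).

(** The residue modulo 6 taken between 1 and 6, as in [letters]; in particular [res6 0 = 6]. *)
Definition res6 (r : nat) : nat := ((r + 5) %% 6).+1.

Definition full_coef (s : letter) (i r : nat) : T -> k := fun x => (full_poly (pt x) s i)`_r.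
Definition partial_coef (s : letter) (i j r : nat) : T -> k :=
  fun x => (partial_poly (pt x) s i j)`_r.

Lemma coef_partial_poly y s i j r :
  (partial_poly (k := k) (tau := tau) y s i j)`_r =
  if r \in exponents tau (s, i, j) then coeff y (s, i, r) else 0.
Proof.
rewrite /partial_poly coef_sum.
have u : uniq (exponents tau (s, i, j)) by rewrite filter_uniq ?iota_uniq.
case: ifPn => [h|h]; last first.
  rewrite big_seq big1 // => r' h'; rewrite coefZ coefXn.
  case: eqP => [e|]; last by rewrite mulr0.
  by rewrite e h' in h.
rewrite (bigD1_seq r) //= coefZ coefXn eqxx mulr1 big1 ?addr0 // => r' h'.
by rewrite coefZ coefXn eq_sym (negbTE h') mulr0.
Qed.

Lemma mem_exponents s i j r : (0 < j <= 6)%N ->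
  (r \in exponents tau (s, i, j)) =
  [&& res6 r == j, 0 < r & r <= formal_degree tau (s, i, j)]%N.
Proof.
move=> hj; rewrite /exponents mem_filter mem_iota /= add1n ltnS.
congr (_ && _); rewrite /res6; apply/eqP/eqP; lia.
Qed.

Lemma coef_full_poly y s i r : (full_poly (k := k) (tau := tau) y s i)`_r =
  \sum_(p <- partials | p.1 == (s, i)) (partial_poly y s i p.2)`_r.
Proof. by rewrite /full_poly coef_sum. Qed.

Lemma coef_full_polyE y s i r : (full_poly (k := k) (tau := tau) y s i)`_r =
  if (s, i, res6 r) \in partials then (partial_poly y s i (res6 r))`_r else 0.
Proof.
have other p : p \in partials -> p.1 == (s, i) -> p.2 != res6 r ->
    (partial_poly (k := k) (tau := tau) y s i p.2)`_r = 0.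
  move=> hp /eqP ep; rewrite eq_sym => hr.
  by rewrite coef_partial_poly mem_exponents ?partials_residue // (negbTE hr).
rewrite coef_full_poly; case: ifPn => hp; last first.
  rewrite big_seq_cond big1 // => p /andP[pin pe]; apply: other => //.
  apply: contra hp => /eqP <-; move/eqP: pe => <-.
  by rewrite -surjective_pairing.
rewrite big_mkcond (bigD1_seq (s, i, res6 r)) //= eqxx.
rewrite big_seq_cond big1 ?addr0 // => p /andP[pin np]; case: ifP => // pe.
apply: other => //; apply: contra np => /eqP e; move/eqP: pe => pe.
by rewrite [p]surjective_pairing pe e.
Qed.

Lemma partial_coefE s i j r : (s, i, j) \in partials ->
  partial_coef s i j r = if res6 r == j then full_coef s i r else 0.
Proof.
move=> hp; apply/funext => x; rewrite /partial_coef /full_coef.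
have hj : (0 < j <= 6)%N := partials_residue hp.
have [e|hr] := eqVneq (res6 r) j; last first.
  by rewrite coef_partial_poly mem_exponents // (negbTE hr).
by rewrite coef_full_polyE e hp.
Qed.

Definition coeff_fun (d : letter * nat * nat) : T -> k := fun x => coeff (pt x) d.

Lemma full_coefE s i r : full_coef s i r =
  if [&& (s, i, res6 r) \in partials, 0 < r & r <= formal_degree tau (s, i, res6 r)]%N
  then coeff_fun (s, i, r) else 0.
Proof.
apply/funext => x; rewrite /full_coef /coeff_fun coef_full_polyE.
case: ifP => // hp; have hj := partials_residue hp.
by rewrite coef_partial_poly mem_exponents // eqxx !andTb; case: ifP.
Qed.

Lemma full_coef_absent s i r : (s, i, res6 r) \notin partials -> full_coef s i r = 0.
Proof. by rewrite full_coefE => /negbTE ->. Qed.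

Lemma full_coef_high s i r : (formal_degree tau (s, i, res6 r) < r)%N -> full_coef s i r = 0.
Proof. by rewrite full_coefE ltnNge => /negbTE ->; rewrite !andbF. Qed.

Lemma full_coef0 s i : full_coef s i 0 = 0.
Proof. by rewrite full_coefE andbF. Qed.

Lemma coeff_fun_notin d : d \notin coeffs tau -> coeff_fun d = 0.
Proof.
move=> h; apply/funext => x; rewrite /coeff_fun /coeff nth_default //.
by rewrite size_tuple leqNgt index_mem.
Qed.

Lemma coeff_fun_coordf d (h : (index d (coeffs tau) < N)%N) :
  coeff_fun d = coordf evpt (Ordinal h).
Proof.
by apply/funext => x; rewrite /coeff_fun /coeff /coordf /evpt (tnth_nth 0).
Qed.

Lemma full_coef_removed i r : (i, r) \in [:: (4, 1); (4, 2); (4, 6)]%N -> full_coef Lg i r = 0.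
Proof.
move=> h; rewrite full_coefE; case: ifP => // _; apply: coeff_fun_notin.
rewrite mem_filter negb_and negbK; apply/orP; left.
by move: h; rewrite !inE !xpair_eqE.
Qed.

Definition prod_coef s i j s' i' r : T -> k :=
  \sum_(a < r.+1) partial_coef s i j a * full_coef s' i' (r - a).

Lemma coef_prod_coef s i j s' i' r x :
  (partial_poly (pt x) s i j * full_poly (pt x) s' i')`_r = prod_coef s i j s' i' r x.
Proof. by rewrite coefM /prod_coef fct_sumE. Qed.

Hypothesis pt_equations : forall x, equations (pt x).

Lemma equation1 r : full_coef Lg 4 r - full_coef Lf 6 r + full_coef Lg 8 r =
  prod_coef Lf 6 1 Lf 9 r + prod_coef Lf 6 3 Lg 7 r
  + (prod_coef Lf 6 4 Lf 6 r - prod_coef Lg 8 4 Lf 6 r)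
  - prod_coef Lg 8 5 Lg 5 r - prod_coef Lg 8 6 Lg 4 r.
Proof.
apply/funext => x; have [h _ _ _ _] := pt_equations x.
by move/(congr1 (coefp r)): h; rewrite /= mulrBl !(coefD, coefN) !coef_prod_coef.
Qed.

Lemma equation2 r : full_coef Lg 5 r - full_coef Lf 6 r + full_coef Lf 9 r =
  prod_coef Lf 6 1 Lf 10 r + prod_coef Lf 6 3 Lf 8 r - prod_coef Lf 9 6 Lg 5 r - prod_coef Lf 9 1 Lg 4 r.
Proof.
apply/funext => x; have [_ h _ _ _] := pt_equations x.
by move/(congr1 (coefp r)): h; rewrite /= !(coefD, coefN) !coef_prod_coef.
Qed.

Lemma equation3 r : full_coef Lg 6 r - full_coef Lf 6 r - full_coef Lf 8 r + full_coef Lf 9 r =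
  prod_coef Lf 8 4 Lg 8 r + prod_coef Lf 8 5 Lg 7 r - prod_coef Lf 9 6 Lg 6 r + prod_coef Lf 8 6 Lf 6 r
  - prod_coef Lf 9 1 Lg 5 r.
Proof.
apply/funext => x; have [_ _ h _ _] := pt_equations x.
by move/(congr1 (coefp r)): h; rewrite /= !(coefD, coefN) !coef_prod_coef.
Qed.

Lemma equation4 r : full_coef Lg 7 r - full_coef Lf 8 r + full_coef Lf 10 r =
  prod_coef Lf 8 4 Lf 9 r + (prod_coef Lf 8 5 Lf 8 r - prod_coef Lf 10 5 Lf 8 r)
  - prod_coef Lf 10 6 Lg 7 r - prod_coef Lf 10 1 Lg 6 r - prod_coef Lf 10 2 Lg 5 r.
Proof.
apply/funext => x; have [_ _ _ h _] := pt_equations x.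
by move/(congr1 (coefp r)): h; rewrite /= mulrBl !(coefD, coefN) !coef_prod_coef.
Qed.

Lemma equation5 r : full_coef Lg 8 r - full_coef Lf 8 r - full_coef Lf 9 r + full_coef Lf 10 r =
  prod_coef Lf 9 6 Lf 8 r - prod_coef Lf 10 5 Lf 9 r - prod_coef Lf 10 6 Lg 8 r
  - prod_coef Lf 10 1 Lg 7 r - prod_coef Lf 10 2 Lf 6 r.
Proof.
apply/funext => x; have [_ _ _ _ h] := pt_equations x.
by move/(congr1 (coefp r)): h; rewrite /= !(coefD, coefN) !coef_prod_coef.
Qed.

Definition inU : {pred 'I_N} := fun i => triple i \in essential tau.
Definition rkU (i : 'I_N) : nat := rank_of ((triple i).1, res6 (triple i).2).

Local Notation F := (fil evpt (weight (tau := tau)) predT (fun=> 1%N)).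
Local Notation Fil := (fil evpt (weight (tau := tau)) inU rkU).

Lemma full_coef_F s i r : F 1 r (full_coef s i r).
Proof.
rewrite full_coefE; case: ifP => _; last exact: mspan0.
have [h|/coeff_fun_notin ->] := boolP ((s, i, r) \in coeffs tau); last exact: mspan0.
have lt : (index (s, i, r) (coeffs tau) < N)%N by rewrite index_mem.
have ew : weight (Ordinal lt) = r by rewrite /weight (tnth_nth (s, i, r)) /= nth_index.
rewrite (coeff_fun_coordf lt) -{1}ew.
exact: (fil_coord evpt (weight (tau := tau)) (fun=> 1%N) (U := predT)).
Qed.

Lemma prod_coef_F s i j s' i' r : (s, i, j) \in partials -> F 2 r (prod_coef s i j s' i' r).
Proof.
move=> hp; apply: mspan_sum => a _.
have := @filM _ _ _ evpt _ predT (fun=> 1%N) 1 a 1 (r - a) (partial_coef s i j a) (full_coef s' i' (r - a)).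
rewrite subnKC -1?ltnS //; apply; last exact: full_coef_F.
by rewrite partial_coefE //; case: ifP => _; [exact: full_coef_F | exact: mspan0].
Qed.

Lemma F_eq j r phi psi : F j r phi -> phi = psi -> F j r psi.
Proof. by move=> h <-. Qed.

Ltac linear := do ?[exact: prod_coef_F | apply: mspanB | apply: mspanD].

(** The right-hand sides consist of products of two coefficients, so the left-hand sides vanish to
    first order. These five relations drive the elimination. *)
Lemma linear1 r : F 2 r (full_coef Lg 4 r - full_coef Lf 6 r + full_coef Lg 8 r).
Proof. by rewrite equation1; linear. Qed.

Lemma linear2 r : F 2 r (full_coef Lg 5 r - full_coef Lf 6 r + full_coef Lf 9 r).
Proof. by rewrite equation2; linear. Qed.

Lemma linear3 r : F 2 r (full_coef Lg 6 r - full_coef Lf 6 r - full_coef Lf 8 r + full_coef Lf 9 r).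
Proof. by rewrite equation3; linear. Qed.

Lemma linear4 r : F 2 r (full_coef Lg 7 r - full_coef Lf 8 r + full_coef Lf 10 r).
Proof. by rewrite equation4; linear. Qed.

Lemma linear5 r : F 2 r (full_coef Lg 8 r - full_coef Lf 8 r - full_coef Lf 9 r + full_coef Lf 10 r).
Proof. by rewrite equation5; linear. Qed.

(* phi is, up to products of at least two coefficients, a linear combination of
   essential coefficients of rank at least rho. *)
Definition lin_rank rho r phi :=
  exists u, [/\ F 1 r u, Fil rho r u & F 2 r (phi - u)].

Lemma lin_rank_F rho r phi : F 2 r phi -> lin_rank rho r phi.
Proof. by exists 0; rewrite subr0; split=> //; exact: mspan0. Qed.

Lemma lin_rank0 rho r : lin_rank rho r 0.
Proof. by apply: lin_rank_F; exact: mspan0. Qed.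

Lemma lin_rank_le rho rho' r phi : (rho' <= rho)%N -> lin_rank rho r phi -> lin_rank rho' r phi.
Proof. by move=> h [u [h1 h2 h3]]; exists u; split=> //; exact: fil_le h2. Qed.

Lemma lin_rankD rho r phi psi : lin_rank rho r phi -> lin_rank rho r psi ->
  lin_rank rho r (phi + psi).
Proof.
move=> [u [h1 h2 h3]] [v [g1 g2 g3]]; exists (u + v); split; try exact: mspanD.
by apply: F_eq (mspanD h3 g3) _; ring.
Qed.

Lemma lin_rankN rho r phi : lin_rank rho r phi -> lin_rank rho r (- phi).
Proof.
move=> [u [h1 h2 h3]]; exists (- u); split; try exact: mspanN.
by apply: F_eq (mspanN h3) _; ring.
Qed.

Lemma lin_rankB rho r phi psi : lin_rank rho r phi -> lin_rank rho r psi ->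
  lin_rank rho r (phi - psi).
Proof. by move=> h /lin_rankN; exact: lin_rankD. Qed.

Lemma lin_rank_mod rho r phi psi eps : lin_rank rho r psi -> F 2 r eps ->
  phi = psi + eps -> lin_rank rho r phi.
Proof. by move=> h /(lin_rank_F rho) h' ->; exact: lin_rankD. Qed.

Lemma lin_rank_essential s i j lo len r : (s, i, j, (lo, len)) \in families tau ->
  res6 r = j -> (j + 6 * lo <= r < j + 6 * (lo + len))%N ->
  lin_rank (rank_of (s, i, j)) r (full_coef s i r).
Proof.
move=> hf hr /andP[r1 r2].
rewrite full_coefE; case: ifP => _; last exact: lin_rank0.
have [h|/coeff_fun_notin ->] := boolP ((s, i, r) \in coeffs tau); last exact: lin_rank0.
have lt : (index (s, i, r) (coeffs tau) < N)%N by rewrite index_mem.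
have et : triple (Ordinal lt) = (s, i, r) by rewrite /triple (tnth_nth (s, i, r)) /= nth_index.
have ew : weight (Ordinal lt) = r by rewrite /weight -/(triple (Ordinal lt)) et.
have ess : inU (Ordinal lt).
  rewrite /inU et; apply/flattenP.
  exists (family_coeffs (s, i, j, (lo, len))); first exact: map_f.
  apply/mapP; exists ((r - j) %/ 6)%N; last by congr (_, _); move: hr; rewrite /res6 /=; lia.
  by rewrite mem_iota /=; move: hr r1 r2; rewrite /res6; lia.
rewrite (coeff_fun_coordf lt); exists (coordf evpt (Ordinal lt)); split.
- by rewrite -{1}ew; exact: (fil_coord evpt (weight (tau := tau)) (fun=> 1%N) (U := predT)).
- have := fil_coord evpt (weight (tau := tau)) rkU ess.
  by rewrite ew /rkU et /= hr.
- by rewrite subrr; exact: mspan0.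
Qed.

(** * Elimination of the linear terms in each residue class *)

Hypothesis tau_gt0 : (0 < tau)%N.

Lemma all_lin_rank3 r :
  [/\ lin_rank 3 r (full_coef Lg 4 r), lin_rank 3 r (full_coef Lg 5 r), lin_rank 3 r (full_coef Lg 6 r),
      lin_rank 3 r (full_coef Lg 7 r) & lin_rank 3 r (full_coef Lg 8 r)] ->
  [/\ lin_rank 3 r (full_coef Lf 6 r), lin_rank 3 r (full_coef Lf 8 r), lin_rank 3 r (full_coef Lf 9 r) &
      lin_rank 3 r (full_coef Lf 10 r)] ->
  forall s i, lin_rank 3 r (full_coef s i r).
Proof.
move=> [h1 h2 h3 h4 h5] [h6 h7 h8 h9] s i.
have [hp|/full_coef_absent->] := boolP ((s, i, res6 r) \in partials); last exact: lin_rank0.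
have : (s, i) \in [seq l.1 | l <- letters].
  by have /allpairsPdep[l [j [hl _ [-> _]]]] := hp; exact: map_f.
by rewrite !inE !xpair_eqE => /or4P[|||/or4P[|||/or3P[]]] /andP[/eqP-> /eqP->].
Qed.

Ltac absent hr := by apply: full_coef_absent; rewrite hr.
Ltac high hr := by apply: full_coef_high; rewrite hr /=; lia.
Ltac essential_at s i j n m hr :=
  by apply: (@lin_rank_essential s i j n m _ _ hr);
    [rewrite !inE !eqxx ?orbT | lia].

Lemma residue1 r : res6 r = 1%N ->
  [/\ lin_rank 4 r (full_coef Lf 6 r), lin_rank 5 r (full_coef Lf 10 r), lin_rank 4 r (full_coef Lg 5 r) &
      forall s i, lin_rank 3 r (full_coef s i r)].
Proof.
move=> hr; have rE : (r %% 6 = 1)%N by move: hr; rewrite /res6; lia.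
have zg8 : full_coef Lg 8 r = 0 by absent hr.
have zf8 : full_coef Lf 8 r = 0 by absent hr.
have E1 := linear1 r; have E2 := linear2 r; have E3 := linear3 r.
have E4 := linear4 r; have E5 := linear5 r.
have f6 : lin_rank 4 r (full_coef Lf 6 r).
  (* Here [r = 1]: since [g_41] is zero, the first equation makes [f_61] quadratic, which is why its
     essential family starts one step later. *)
  have [r1|r1] := leqP r 6.
    have zg4 : full_coef Lg 4 r = 0 by rewrite (_ : r = 1)%N; [exact: full_coef_removed | lia].
    by apply: lin_rank_F; apply: F_eq (mspanN E1) _; rewrite zg4 zg8; ring.
  have [r2|r2] := leqP r (1 + 6 * tau); first by essential_at Lf 6%N 1%N 1%N tau hr.
  by rewrite (_ : full_coef _ _ _ = 0); [exact: lin_rank0 | high hr].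
have f10 : lin_rank 5 r (full_coef Lf 10 r).
  have [r2|r2] := leqP r (1 + 6 * tau); first by essential_at Lf 10%N 1%N 0%N tau.+1 hr.
  (* The formal degree [7 + 6 * tau] leaves one coefficient outside the essential family; adding the
     fifth and second equations cancels [f_9] and shows it to be quadratic. *)
  have zf6 : full_coef Lf 6 r = 0 by high hr.
  have zg5 : full_coef Lg 5 r = 0 by high hr.
  by apply: lin_rank_F; apply: F_eq (mspanD E5 E2) _; rewrite zf6 zg5 zg8 zf8; ring.
have f9 : lin_rank 5 r (full_coef Lf 9 r).
  by apply: (lin_rank_mod f10 (mspanN E5)); rewrite zg8 zf8; ring.
have le := @lin_rank_le.
have g5 : lin_rank 4 r (full_coef Lg 5 r).
  by apply: (lin_rank_mod (lin_rankB f6 (le _ 4%N _ _ _ f9)) E2); rewrite ?zg8 //; ring.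
split=> //; apply: all_lin_rank3; split.
- by apply: (lin_rank_mod (le _ 3%N _ _ _ f6) E1) => //; rewrite zg8; ring.
- exact: le g5.
- by apply: (lin_rank_mod (lin_rankB (le _ 3%N _ _ _ f6) (le _ 3%N _ _ _ f9)) E3) => //;
    rewrite zf8; ring.
- by apply: (lin_rank_mod (lin_rankN (le _ 3%N _ _ _ f10)) E4) => //; rewrite zf8; ring.
- by rewrite zg8; exact: lin_rank0.
- exact: le f6.
- by rewrite zf8; exact: lin_rank0.
- exact: le f9.
- exact: le f10.
Qed.

Lemma residue2 r : res6 r = 2%N ->
  [/\ lin_rank 5 r (full_coef Lg 7 r), lin_rank 4 r (full_coef Lf 10 r) &
      forall s i, lin_rank 3 r (full_coef s i r)].
Proof.
move=> hr; have rE : (r %% 6 = 2)%N by move: hr; rewrite /res6; lia.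
have E1 := linear1 r; have E2 := linear2 r; have E3 := linear3 r.
have E4 := linear4 r; have E5 := linear5 r.
have le := @lin_rank_le.
have zf6 : full_coef Lf 6 r = 0 by absent hr.
have zf9 : full_coef Lf 9 r = 0 by absent hr.
have g8 : lin_rank 5 r (full_coef Lg 8 r).
  have [r1|r1] := leqP r 7.
    have zg4 : full_coef Lg 4 r = 0 by rewrite (_ : r = 2)%N; [exact: full_coef_removed | lia].
    by apply: lin_rank_F; apply: F_eq E1 _; rewrite zg4 zf6; ring.
  (* The formal degree is [8 + 12 * tau], but beyond [2 + 6 * tau] the only linear term of the first
     equation is [g_8]. *)
  have [r2|r2] := leqP r (2 + 6 * tau); first by essential_at Lg 8%N 2%N 1%N tau hr.
  have zg4 : full_coef Lg 4 r = 0 by high hr.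
  by apply: lin_rank_F; apply: F_eq E1 _; rewrite zg4 zf6; ring.
have f10 : lin_rank 4 r (full_coef Lf 10 r).
  have [r2|r2] := leqP r (2 + 6 * tau); first by essential_at Lf 10%N 2%N 0%N tau.+1 hr.
  have zg7 : full_coef Lg 7 r = 0 by high hr.
  have zg6 : full_coef Lg 6 r = 0 by high hr.
  by apply: lin_rank_F; apply: F_eq (mspanB E4 E3) _; rewrite zg7 zg6 zf6 zf9; ring.
have g7 : lin_rank 5 r (full_coef Lg 7 r).
  by apply: (lin_rank_mod g8 (mspanB E4 E5)); rewrite zf9; ring.
have f8 : lin_rank 3 r (full_coef Lf 8 r).
  apply: (lin_rank_mod (lin_rankD (le _ 3%N _ _ _ g8) (le _ 3%N _ _ _ f10)) (mspanN E5)) => //.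
  by rewrite zf9; ring.
split=> //; apply: all_lin_rank3; split.
- by apply: (lin_rank_mod (lin_rankN (le _ 3%N _ _ _ g8)) E1) => //; rewrite zf6; ring.
- by apply: lin_rank_F; apply: F_eq E2 _; rewrite zf6 zf9; ring.
- by apply: (lin_rank_mod f8 E3); rewrite zf6 zf9; ring.
- exact: le g7.
- exact: le g8.
- by rewrite zf6; exact: lin_rank0.
- exact: f8.
- by rewrite zf9; exact: lin_rank0.
- exact: le f10.
Qed.

Lemma residue3 r : res6 r = 3%N ->
  lin_rank 4 r (full_coef Lf 6 r) /\ forall s i, lin_rank 3 r (full_coef s i r).
Proof.
move=> hr; have rE : (r %% 6 = 3)%N by move: hr; rewrite /res6; lia.
have E1 := linear1 r; have E2 := linear2 r; have E3 := linear3 r.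
have E4 := linear4 r; have E5 := linear5 r.
have le := @lin_rank_le.
have zg4 : full_coef Lg 4 r = 0 by absent hr.
have zf8 : full_coef Lf 8 r = 0 by absent hr.
have zf10 : full_coef Lf 10 r = 0 by absent hr.
have f6 : lin_rank 4 r (full_coef Lf 6 r).
  have [r2|r2] := leqP r (3 + 6 * tau); first by essential_at Lf 6%N 3%N 0%N tau.+1 hr.
  by rewrite (_ : full_coef _ _ _ = 0); [exact: lin_rank0 | high hr].
have f6' := le 4%N 3%N _ _ isT f6.
have g8 : lin_rank 3 r (full_coef Lg 8 r).
  by apply: (lin_rank_mod f6' E1); rewrite zg4; ring.
have f9 : lin_rank 3 r (full_coef Lf 9 r).
  by apply: (lin_rank_mod g8 (mspanN E5)); rewrite zf8 zf10; ring.
split=> //; apply: all_lin_rank3; split=> //.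
- by rewrite zg4; exact: lin_rank0.
- by apply: (lin_rank_mod (lin_rankB f6' f9) E2); ring.
- by apply: (lin_rank_mod (lin_rankB f6' f9) E3); rewrite zf8; ring.
- by apply: lin_rank_F; apply: F_eq E4 _; rewrite zf8 zf10; ring.
- by rewrite zf8; exact: lin_rank0.
- by rewrite zf10; exact: lin_rank0.
Qed.

(** Neither [g_5] nor [f_9] has terms of residue 4, so the second equation makes [f_6] quadratic. *)
Lemma residue4 r : res6 r = 4%N ->
  [/\ F 2 r (full_coef Lf 6 r), lin_rank 4 r (full_coef Lg 7 r), lin_rank 4 r (full_coef Lg 8 r) &
      forall s i, lin_rank 3 r (full_coef s i r)].
Proof.
move=> hr; have rE : (r %% 6 = 4)%N by move: hr; rewrite /res6; lia.
have E1 := linear1 r; have E2 := linear2 r; have E3 := linear3 r.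
have E4 := linear4 r; have E5 := linear5 r.
have le := @lin_rank_le.
have zg5 : full_coef Lg 5 r = 0 by absent hr.
have zf9 : full_coef Lf 9 r = 0 by absent hr.
have f6 : F 2 r (full_coef Lf 6 r) by apply: F_eq (mspanN E2) _; rewrite zg5 zf9; ring.
have g8 : lin_rank 4 r (full_coef Lg 8 r).
  have [r2|r2] := leqP r (4 + 6 * tau); first by essential_at Lg 8%N 4%N 0%N tau.+1 hr.
  by rewrite (_ : full_coef _ _ _ = 0); [exact: lin_rank0 | high hr].
have f8 : lin_rank 3 r (full_coef Lf 8 r).
  have [r2|r2] := leqP r (4 + 6 * tau); first by essential_at Lf 8%N 4%N 0%N tau.+1 hr.
  by rewrite (_ : full_coef _ _ _ = 0); [exact: lin_rank0 | high hr].
have g7 : lin_rank 4 r (full_coef Lg 7 r).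
  by apply: (lin_rank_mod g8 (mspanB E4 E5)); rewrite zf9; ring.
have g8' := le 4%N 3%N _ _ isT g8.
have f6' := lin_rank_F 3 f6.
split=> //; apply: all_lin_rank3; split=> //.
- by apply: (lin_rank_mod (lin_rankB f6' g8') E1); ring.
- by rewrite zg5; exact: lin_rank0.
- by apply: (lin_rank_mod (lin_rankD f6' f8) E3); rewrite zf9; ring.
- exact: le g7.
- by rewrite zf9; exact: lin_rank0.
- by apply: (lin_rank_mod (lin_rankB f8 g8') E5); rewrite zf9; ring.
Qed.

(** As [g_6], [f_6] and [f_9] have no terms of residue 5, the third equation makes [f_8] quadratic,
    and the fifth then gives [f_10 = - g_8] modulo products. This lets [g_8] stand for [f_10] in a
    leading product later. *)
Lemma residue5 r : res6 r = 5%N ->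
  [/\ F 2 r (full_coef Lf 8 r), F 2 r (full_coef Lf 10 r + full_coef Lg 8 r), lin_rank 4 r (full_coef Lg 8 r) &
      lin_rank 4 r (full_coef Lg 4 r)] /\
  lin_rank 4 r (full_coef Lf 10 r) /\ forall s i, lin_rank 3 r (full_coef s i r).
Proof.
move=> hr; have rE : (r %% 6 = 5)%N by move: hr; rewrite /res6; lia.
have E1 := linear1 r; have E2 := linear2 r; have E3 := linear3 r.
have E4 := linear4 r; have E5 := linear5 r.
have le := @lin_rank_le.
have zg6 : full_coef Lg 6 r = 0 by absent hr.
have zf6 : full_coef Lf 6 r = 0 by absent hr.
have zf9 : full_coef Lf 9 r = 0 by absent hr.
have f8 : F 2 r (full_coef Lf 8 r) by apply: F_eq (mspanN E3) _; rewrite zg6 zf6 zf9; ring.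
have f10g8 : F 2 r (full_coef Lf 10 r + full_coef Lg 8 r).
  by apply: F_eq (mspanD E5 f8) _; rewrite zf9; ring.
have g8 : lin_rank 4 r (full_coef Lg 8 r).
  have [r2|r2] := ltnP r (5 + 6 * tau); first by essential_at Lg 8%N 5%N 0%N tau hr.
  have zg4 : full_coef Lg 4 r = 0 by high hr.
  by apply: lin_rank_F; apply: F_eq E1 _; rewrite zg4 zf6; ring.
have g4 : lin_rank 4 r (full_coef Lg 4 r).
  by apply: (lin_rank_mod (lin_rankN g8) E1); rewrite zf6; ring.
have f10 : lin_rank 4 r (full_coef Lf 10 r).
  by apply: (lin_rank_mod (lin_rankN g8) f10g8); ring.
have f8' := lin_rank_F 3 f8.
split=> //; split=> //; apply: all_lin_rank3; split=> //; try exact: le g8;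
  try exact: le g4; try exact: le f10.
- by apply: lin_rank_F; apply: F_eq E2 _; rewrite zf6 zf9; ring.
- by rewrite zg6; exact: lin_rank0.
- by apply: (lin_rank_mod (lin_rankB f8' (le _ 3%N _ _ _ f10)) E4) => //; ring.
- by rewrite zf6; exact: lin_rank0.
- by rewrite zf9; exact: lin_rank0.
Qed.

Lemma residue6 r : res6 r = 6%N ->
  [/\ lin_rank 5 r (full_coef Lg 8 r), lin_rank 5 r (full_coef Lg 5 r), lin_rank 5 r (full_coef Lf 9 r),
      lin_rank 5 r (full_coef Lf 10 r) & forall s i, lin_rank 3 r (full_coef s i r)].
Proof.
move=> hr; have rE : (r %% 6 = 0)%N by move: hr; rewrite /res6; lia.
have E1 := linear1 r; have E2 := linear2 r; have E3 := linear3 r.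
have E4 := linear4 r; have E5 := linear5 r.
have le := @lin_rank_le.
have zg7 : full_coef Lg 7 r = 0 by absent hr.
(* Degree 0 falls in this class because [res6 0 = 6]; its coefficients are zero, as exponents start
   at 1. *)
have [r0|r0] := posnP r.
  by split=> [||||s i]; rewrite r0 full_coef0; exact: lin_rank0.
have g8 : lin_rank 5 r (full_coef Lg 8 r).
  have [r2|r2] := leqP r (6 + 6 * tau); first by essential_at Lg 8%N 6%N 0%N tau.+1 hr.
  by rewrite (_ : full_coef _ _ _ = 0); [exact: lin_rank0 | high hr].
have f8 : lin_rank 5 r (full_coef Lf 8 r).
  have [r2|r2] := leqP r (6 + 6 * tau); first by essential_at Lf 8%N 6%N 0%N tau.+1 hr.
  by rewrite (_ : full_coef _ _ _ = 0); [exact: lin_rank0 | high hr].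
have g4 : lin_rank 5 r (full_coef Lg 4 r).
  have [r1|r1] := leqP r 6.
    rewrite (_ : full_coef _ _ _ = 0); first exact: lin_rank0.
    by rewrite (_ : r = 6)%N; [exact: full_coef_removed | lia].
  have [r2|r2] := leqP r (6 * tau); first by essential_at Lg 4%N 6%N 1%N tau.-1 hr.
  by rewrite (_ : full_coef _ _ _ = 0); [exact: lin_rank0 | high hr].
have f10 : lin_rank 5 r (full_coef Lf 10 r).
  by apply: (lin_rank_mod f8 E4); rewrite zg7; ring.
have f9 : lin_rank 5 r (full_coef Lf 9 r).
  by apply: (lin_rank_mod g8 (mspanB E4 E5)); rewrite zg7; ring.
have f6 : lin_rank 5 r (full_coef Lf 6 r).
  by apply: (lin_rank_mod (lin_rankD g4 g8) (mspanN E1)); ring.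
have g5 : lin_rank 5 r (full_coef Lg 5 r).
  by apply: (lin_rank_mod (lin_rankB f6 f9) E2); ring.
have g6 : lin_rank 5 r (full_coef Lg 6 r).
  by apply: (lin_rank_mod (lin_rankB (lin_rankD f6 f8) f9) E3); ring.
split=> //; apply: all_lin_rank3; split; rewrite ?zg7; try exact: lin_rank0; exact: (le 5%N).
Qed.

End CoefficientFunctions.

(** * Quadratic leading relations in high degree *)

Section LeadingRelations.
Local Open Scope ring_scope.
Context {k : fieldType} {tau : nat} {T : Type}.
Variable pt : T -> affine k (size (coeffs tau)).
Hypothesis tau_gt0 : (0 < tau)%N.
Hypothesis pt_equations : forall x, equations (pt x).

Local Notation N := (size (coeffs tau)).
Local Notation full_coef := (full_coef pt).
Local Notation partial_coef := (partial_coef pt).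
Local Notation prod_coef := (prod_coef pt).
Local Notation evpt := (coordinates pt).
Local Notation inU := (@inU tau).
Local Notation rkU := (@rkU tau).
Local Notation lin_rank := (lin_rank pt).
Local Notation F := (fil evpt (weight (tau := tau)) predT (fun=> 1%N)).
Local Notation Fil := (fil evpt (weight (tau := tau)) inU rkU).

Lemma lin_rank3 s i r : lin_rank 3 r (full_coef s i r).
Proof.
have [j hr hj] : exists2 j, res6 r = j & (0 < j <= 6)%N.
  by exists (res6 r) => //; rewrite /res6; lia.
case: j hj hr => [//|[|[|[|[|[|[|//]]]]]]] _ hr.
- by have [_ _ _] := residue1 pt_equations tau_gt0 hr.
- by have [_ _] := residue2 pt_equations tau_gt0 hr.
- by have [_] := residue3 pt_equations tau_gt0 hr.
- by have [_ _ _] := residue4 pt_equations tau_gt0 hr.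
- by have [_ [_]] := residue5 pt_equations tau_gt0 hr.
- by have [_ _ _ _] := residue6 pt_equations tau_gt0 hr.
Qed.

Lemma triple_mem (i : 'I_N) : [/\ ((triple i).1, res6 (triple i).2) \in partials, (0 < (triple i).2)%N &
  ((triple i).2 <= formal_degree tau ((triple i).1, res6 (triple i).2))%N].
Proof.
have := mem_tnth i (in_tuple (coeffs tau)); rewrite -/(triple i).
rewrite [X in _ \in X]/= mem_filter => /andP[_ /allpairsPdep[[[s i'] j] [r [hp hr ->]]]].
have hj : (0 < j <= 6)%N := partials_residue hp.
by move: hr; rewrite mem_exponents // => /and3P[/eqP hj' r0 r1]; rewrite [_.1]/= [_.2]/= hj'.
Qed.

Lemma coordf_full_coef (i : 'I_N) : coordf evpt i = full_coef (triple i).1.1 (triple i).1.2 (triple i).2.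
Proof.
case e : (triple i) (triple_mem i) => [[s i'] r] [h1 h2 h3].
rewrite -[RHS]/(full_coef s i' r) full_coefE.
rewrite -[_ && _]/[&& ((s, i', r).1, res6 (s, i', r).2) \in partials, _ & _] h1 h2 h3.
apply/funext => x; rewrite /coordf /coordinates /coeff_fun /coeff -e /triple.
by rewrite (tnth_nth 0) [in RHS](tnth_nth (triple i)) /= index_uniq // uniq_coeffs.
Qed.

Lemma coordf_lin i : exists u : T -> k,
  [/\ F 1 (weight i) u, Fil 3 (weight i) u & F 2 (weight i) (coordf evpt i - u)].
Proof. by rewrite coordf_full_coef; exact: lin_rank3. Qed.

Lemma F_Fil j r phi : F j r phi -> Fil (3 * j) r phi.
Proof. exact: (fil_deg_fil (@weight_gt0 tau) coordf_lin). Qed.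

(** The quadratic remainder has rank at least [3 * 2 = 6], above the rank of every essential
    coefficient. *)
Lemma lin_rank_Fil rho r phi : (rho <= 6)%N -> lin_rank rho r phi -> Fil rho r phi.
Proof.
move=> h [u [_ h2 h3]]; rewrite -(subrK u phi); apply: mspanD => //.
by apply: fil_le (F_Fil h3).
Qed.

Definition coef_rank s i j rho := forall r, res6 r = j -> Fil rho r (full_coef s i r).

Lemma coef_rank3 s i j : coef_rank s i j 3.
Proof. by move=> r _; apply: lin_rank_Fil => //; exact: lin_rank3. Qed.

Lemma coef_rank_absent s i j rho : (s, i, j) \notin partials -> coef_rank s i j rho.
Proof. by move=> h r hr; rewrite full_coef_absent ?hr //; exact: mspan0. Qed.

Lemma partial_coef_Fil s i j rho r : (s, i, j) \in partials -> coef_rank s i j rho ->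
  Fil rho r (partial_coef s i j r).
Proof.
by move=> hp h; rewrite partial_coefE //; case: eqP => [/h|_] //; exact: mspan0.
Qed.

Lemma prod_coef_Fil s i j s' i' j' rho rho' r : (s, i, j) \in partials -> (0 < j' <= 6)%N ->
  r = (j + j')%N %[mod 6] -> coef_rank s i j rho -> coef_rank s' i' j' rho' ->
  Fil (rho + rho') r (prod_coef s i j s' i' r).
Proof.
move=> hp hj' hr h h'; apply: mspan_sum => a _; have ar : (a <= r)%N by rewrite -ltnS.
rewrite partial_coefE //; case: eqP => [ea|_]; last by rewrite mul0r; exact: mspan0.
have := filM (h _ ea) (h' (r - a)%N _); rewrite subnKC //; apply.
by move: ea hr ar; rewrite /res6 => <-; lia.
Qed.

Lemma prod_coefE s i j s' i' j' r : (s, i, j) \in partials -> (s', i', j') \in partials ->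
  r = (j + j')%N %[mod 6] ->
  prod_coef s i j s' i' r = \sum_(a < r.+1) partial_coef s i j a * partial_coef s' i' j' (r - a)%N.
Proof.
move=> hp hp' hr; apply: eq_bigr => a _; have ar : (a <= r)%N by rewrite -ltnS.
rewrite !partial_coefE //; case: eqP => [ea|_]; last by rewrite !mul0r.
have hj' : (0 < j' <= 6)%N := partials_residue hp'.
case: eqP => // - []; move: ea hr ar hj'; rewrite /res6 => <-; lia.
Qed.

Lemma partial_prod_residue s i j s' i' j' r : (s, i, j) \in partials ->
  (s', i', j') \in partials -> r <> (j + j')%N %[mod 6] ->
  \sum_(a < r.+1) partial_coef s i j a * partial_coef s' i' j' (r - a)%N = 0.
Proof.
move=> hp hp' hr; rewrite big1 // => a _; have ar : (a <= r)%N by rewrite -ltnS.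
rewrite !partial_coefE //; case: eqP => [ea|_]; last by rewrite !mul0r.
case: eqP => [eb|_]; last by rewrite mulr0.
by case: hr; move: ea eb ar; rewrite /res6; lia.
Qed.

(** The improvements on the general rank 3 used below. Rank 6 occurs for the coefficients without
    linear part. *)
Lemma coef_ranks :
  [/\ coef_rank Lf 6 1 4, coef_rank Lf 10 1 5, coef_rank Lg 5 1 4,
      coef_rank Lg 7 2 5 & coef_rank Lf 10 2 4] /\
  [/\ coef_rank Lf 6 3 4, coef_rank Lf 6 4 6, coef_rank Lg 7 4 4 & coef_rank Lg 8 4 4] /\
  [/\ coef_rank Lf 8 5 6, coef_rank Lg 8 5 4, coef_rank Lg 4 5 4 & coef_rank Lf 10 5 4] /\
  [/\ coef_rank Lg 8 6 5, coef_rank Lg 5 6 5, coef_rank Lf 9 6 5 & coef_rank Lf 10 6 5].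
Proof.
have L rho r phi : (rho <= 6)%N -> lin_rank rho r phi -> Fil rho r phi := @lin_rank_Fil rho r phi.
have P2 r phi : F 2 r phi -> Fil 6 r phi by exact: F_Fil.
split; [|split; [|split]]; split=> r hr.
- by have [h _ _ _] := residue1 pt_equations tau_gt0 hr; apply: (L _ _ _ _ h).
- by have [_ h _ _] := residue1 pt_equations tau_gt0 hr; apply: (L _ _ _ _ h).
- by have [_ _ h _] := residue1 pt_equations tau_gt0 hr; apply: (L _ _ _ _ h).
- by have [h _ _] := residue2 pt_equations tau_gt0 hr; apply: (L _ _ _ _ h).
- by have [_ h _] := residue2 pt_equations tau_gt0 hr; apply: (L _ _ _ _ h).
- by have [h _] := residue3 pt_equations tau_gt0 hr; apply: (L _ _ _ _ h).
- by have [h _ _ _] := residue4 pt_equations tau_gt0 hr; exact: P2.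
- by have [_ h _ _] := residue4 pt_equations tau_gt0 hr; apply: (L _ _ _ _ h).
- by have [_ _ h _] := residue4 pt_equations tau_gt0 hr; apply: (L _ _ _ _ h).
- by have [[h _ _ _] _] := residue5 pt_equations tau_gt0 hr; exact: P2.
- by have [[_ _ h _] _] := residue5 pt_equations tau_gt0 hr; apply: (L _ _ _ _ h).
- by have [[_ _ _ h] _] := residue5 pt_equations tau_gt0 hr; apply: (L _ _ _ _ h).
- by have [_ [h _]] := residue5 pt_equations tau_gt0 hr; apply: (L _ _ _ _ h).
- by have [h _ _ _ _] := residue6 pt_equations tau_gt0 hr; apply: (L _ _ _ _ h).
- by have [_ h _ _ _] := residue6 pt_equations tau_gt0 hr; apply: (L _ _ _ _ h).
- by have [_ _ h _ _] := residue6 pt_equations tau_gt0 hr; apply: (L _ _ _ _ h).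
- by have [_ _ _ h _] := residue6 pt_equations tau_gt0 hr; apply: (L _ _ _ _ h).
Qed.

Ltac split_sum :=
  lazymatch goal with
  | |- _ (- _) => apply: mspanN; split_sum
  | |- _ (_ + _) => apply: mspanD; split_sum
  | _ => idtac
  end.

Ltac product j' rho rho' :=
  apply: (@fil_le _ _ _ _ _ _ _ (rho + rho')%N); first by [];
  apply: (@prod_coef_Fil _ _ _ _ _ j' rho rho') => //;
  try exact: coef_rank3; try by apply: coef_rank_absent.

(** In residue 5 beyond [5 + 6 * tau], the first equation has no linear terms left. Its product
    [g_8^(4) f_6^(1)] has rank [4 + 4], and all the others have rank at least 9; in the other
    residues the sum is empty of nonzero terms. *)
Lemma leading_relation1 r : (11 + 6 * tau <= r)%N ->
  Fil 9 r (\sum_(a < r.+1) partial_coef Lg 8 4 a * partial_coef Lf 6 1 (r - a)%N).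
Proof.
move=> hr; have [r5|r5] := eqVneq (r %% 6)%N 5%N; last first.
  by rewrite partial_prod_residue //; [exact: mspan0 | move=> /=; move/eqP: r5; lia].
have res : res6 r = 5%N by rewrite /res6; lia.
have [[f61 _ _ g72 _] [[f63 f64 _ _] [[_ g85 g45 _] [g86 g56 _ _]]]] := coef_ranks.
have e := equation1 pt_equations r.
have zg4 : full_coef Lg 4 r = 0 by apply: full_coef_high; rewrite res /=; lia.
have zf6 : full_coef Lf 6 r = 0 by apply: full_coef_absent; rewrite res.
have zg8 : full_coef Lg 8 r = 0 by apply: full_coef_high; rewrite res /=; lia.
rewrite -(@prod_coefE Lg 8 4 Lf 6 1 r isT isT r5).
rewrite zg4 zf6 zg8 subrr addr0 in e.
rewrite (_ : prod_coef Lg 8 4 Lf 6 r = prod_coef Lf 6 1 Lf 9 r + prod_coef Lf 6 3 Lg 7 r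
  + prod_coef Lf 6 4 Lf 6 r - prod_coef Lg 8 5 Lg 5 r - prod_coef Lg 8 6 Lg 4 r); last first.
  by rewrite -[LHS]addr0 e; ring.
split_sum.
- by product 4%N 4%N 5%N.
- by product 2%N 4%N 5%N.
- by product 1%N 6%N 3%N.
- by product 6%N 4%N 5%N.
- by product 5%N 5%N 4%N.
Qed.

(** The same for the fifth equation, where all products except [f_10^(2) f_6^(3)] have rank at least
    9. *)
Lemma leading_relation2 r : (11 + 6 * tau <= r)%N ->
  Fil 9 r (\sum_(a < r.+1) partial_coef Lf 10 2 a * partial_coef Lf 6 3 (r - a)%N).
Proof.
move=> hr; have [r5|r5] := eqVneq (r %% 6)%N 5%N; last first.
  by rewrite partial_prod_residue //; [exact: mspan0 | move=> /=; move/eqP: r5; lia].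
have res : res6 r = 5%N by rewrite /res6; lia.
have [[_ f101 _ _ _] [[f63 _ g74 _] [[f85 g85 _ f105] [_ _ f96 f106]]]] := coef_ranks.
have e := equation5 pt_equations r.
have zg8 : full_coef Lg 8 r = 0 by apply: full_coef_high; rewrite res /=; lia.
have zf8 : full_coef Lf 8 r = 0 by apply: full_coef_high; rewrite res /=; lia.
have zf9 : full_coef Lf 9 r = 0 by apply: full_coef_absent; rewrite res.
have zf10 : full_coef Lf 10 r = 0 by apply: full_coef_high; rewrite res /=; lia.
rewrite -(@prod_coefE Lf 10 2 Lf 6 3 r isT isT r5).
rewrite zg8 zf8 zf9 zf10 !subr0 addr0 in e.
rewrite (_ : prod_coef Lf 10 2 Lf 6 r = prod_coef Lf 9 6 Lf 8 r - prod_coef Lf 10 5 Lf 9 r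
  - prod_coef Lf 10 6 Lg 8 r - prod_coef Lf 10 1 Lg 7 r); last first.
  by rewrite -[LHS]addr0 e; ring.
split_sum.
- by product 5%N 5%N 6%N.
- by product 6%N 4%N 5%N.
- by product 5%N 5%N 4%N.
- by product 4%N 5%N 4%N.
Qed.

(** In residue 3 the fourth equation isolates [f_10^(5) f_8^(4)], of rank [4 + 3], and [f_10^(5)]
    equals [- g_8^(5)] modulo products. *)
Lemma leading_relation3 r : (9 + 6 * tau <= r)%N ->
  Fil 8 r (\sum_(a < r.+1) partial_coef Lg 8 5 a * partial_coef Lf 8 4 (r - a)%N).
Proof.
move=> hr; have [r3|r3] := eqVneq (r %% 6)%N 3%N; last first.
  by rewrite partial_prod_residue //; [exact: mspan0 | move=> /=; move/eqP: r3; lia].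
have res : res6 r = 3%N by rewrite /res6; lia.
have [[_ f101 g51 _ f102] [_ [[f85 _ _ f105] [_ _ _ f106]]]] := coef_ranks.
have e := equation4 pt_equations r.
have zg7 : full_coef Lg 7 r = 0 by apply: full_coef_high; rewrite res /=; lia.
have zf8 : full_coef Lf 8 r = 0 by apply: full_coef_absent; rewrite res.
have zf10 : full_coef Lf 10 r = 0 by apply: full_coef_absent; rewrite res.
rewrite zg7 zf8 zf10 !subr0 addr0 in e.
have lead : Fil 8 r (prod_coef Lf 10 5 Lf 8 r).
  rewrite (_ : prod_coef Lf 10 5 Lf 8 r = prod_coef Lf 8 4 Lf 9 r + prod_coef Lf 8 5 Lf 8 r
    - prod_coef Lf 10 6 Lg 7 r - prod_coef Lf 10 1 Lg 6 r - prod_coef Lf 10 2 Lg 5 r); last first.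
    by rewrite -[LHS]addr0 e; ring.
  split_sum.
  - by product 5%N 3%N 5%N.
  - by product 4%N 6%N 3%N.
  - by product 3%N 5%N 3%N.
  - by product 2%N 5%N 3%N.
  - by product 1%N 4%N 4%N.
have f84 := @coef_rank3 Lf 8 4.
rewrite (_ : \sum_(a < _) _ =
  \sum_(a < r.+1) (partial_coef Lf 10 5 a + partial_coef Lg 8 5 a) * partial_coef Lf 8 4 (r - a)%N
  - prod_coef Lf 10 5 Lf 8 r); last first.
  rewrite (@prod_coefE Lf 10 5 Lf 8 4 r isT isT r3) -sumrB; apply: eq_bigr => a _; ring.
(* The factor [f_10^(5) + g_8^(5)] is quadratic, hence of rank 6 instead of 4. *)
apply: mspanB => //; apply: mspan_sum => a _.
apply: (@fil_le _ _ _ _ _ _ _ (6 + 3)%N) => //.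
have ar : (a <= r)%N by rewrite -ltnS.
rewrite -[X in fil _ _ _ _ _ X _](subnKC ar); apply: filM; last exact: partial_coef_Fil.
rewrite !partial_coefE //; case: eqP => [ha|_]; last by rewrite addr0; exact: mspan0.
by have [[_ h _ _] _] := residue5 pt_equations tau_gt0 ha; exact: F_Fil h.
Qed.

(* (p, q, r0): the coefficients of t^r, r >= r0, of the product of the partial polynomials
   p and q vanish modulo terms of higher rank. *)
Definition lead_pairs : seq (letter * nat * nat * (letter * nat * nat) * nat) :=
  [:: ((Lg, 8, 5), (Lf, 8, 4), 9 + 6 * tau); ((Lg, 8, 4), (Lf, 6, 1), 11 + 6 * tau);
      ((Lf, 10, 2), (Lf, 6, 3), 11 + 6 * tau)]%N.

Lemma lead_nilp p q r0 a b : (p, q, r0) \in lead_pairs -> (r0 <= a + b)%N ->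
  gr_nilp evpt (weight (tau := tau)) inU rkU (rank_of p + rank_of q) (a + b)
    (partial_coef p.1.1 p.1.2 p.2 a * partial_coef q.1.1 q.1.2 q.2 b).
Proof.
(* [12 * tau + 20] is a generous bound, above all formal degrees. *)
have high p' c : p' \in partials -> (12 * tau + 20 <= c)%N ->
    partial_coef p'.1.1 p'.1.2 p'.2 c = 0.
  case: p' => -[s i] j hp hc; rewrite partial_coefE //; case: eqP => // e.
  apply: full_coef_high; apply: leq_trans hc; rewrite e.
  have : (i <= 10)%N && (j <= 6)%N.
    by apply: (allP (_ : all (fun p => (p.1.2 <= 10) && (p.2 <= 6))%N partials) _ hp).
  move=> /andP[hi hj]; rewrite /formal_degree.
  by do 3?[case: ifP => _] => /=; lia.
have [[f61 _ _ _ f102] [[f63 _ _ g84] [[_ g85 _ _] _]]] := coef_ranks.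
have f84 := @coef_rank3 Lf 8 4.
rewrite !inE !xpair_eqE => /or3P[] /andP[/andP[/eqP -> /eqP ->] /eqP ->] hr.
- apply: (gr_nilp_coef_prod (B := (12 * tau + 20)%N) (r0 := (9 + 6 * tau)%N)) => // c.
  + exact: partial_coef_Fil.
  + exact: partial_coef_Fil.
  + exact: (high (Lg, 8, 5)%N).
  + exact: (high (Lf, 8, 4)%N).
  + exact: leading_relation3.
- apply: (gr_nilp_coef_prod (B := (12 * tau + 20)%N) (r0 := (11 + 6 * tau)%N)) => // c.
  + exact: partial_coef_Fil.
  + exact: partial_coef_Fil.
  + exact: (high (Lg, 8, 4)%N).
  + exact: (high (Lf, 6, 1)%N).
  + exact: leading_relation1.
- apply: (gr_nilp_coef_prod (B := (12 * tau + 20)%N) (r0 := (11 + 6 * tau)%N)) => // c.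
  + exact: partial_coef_Fil.
  + exact: partial_coef_Fil.
  + exact: (high (Lf, 10, 2)%N).
  + exact: (high (Lf, 6, 3)%N).
  + exact: leading_relation2.
Qed.

Definition kind (i : 'I_N) := ((triple i).1, res6 (triple i).2).

Definition bad (i j : 'I_N) := [&& inU i, inU j &
  has (fun e => [&& kind i == e.1.1, kind j == e.1.2 & e.2 <= (triple i).2 + (triple j).2]%N)
    lead_pairs].

Lemma coordf_partial_coef (i : 'I_N) :
  coordf evpt i = partial_coef (kind i).1.1 (kind i).1.2 (kind i).2 (triple i).2.
Proof.
by have [h _ _] := triple_mem i; rewrite coordf_full_coef partial_coefE /kind /= ?eqxx //.
Qed.

Lemma bad_nilp i j : bad i j -> [/\ inU i, inU j, i != j &
  gr_nilp evpt (weight (tau := tau)) inU rkU (rkU i + rkU j) (weight i + weight j)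
    (coordf evpt i * coordf evpt j)].
Proof.
move=> /and3P[Ui Uj /hasP[[[p q] r0] he /and3P[/eqP /= ki /eqP kj hr]]]; split=> //.
  have /allP/(_ _ he) : all (fun e => e.1.1 != e.1.2) lead_pairs by [].
  by rewrite /= -ki -kj; apply: contraNneq => ->.
by rewrite !coordf_partial_coef ki kj /rkU -/(kind i) -/(kind j) ki kj; exact: lead_nilp he hr.
Qed.

(** * Counting essential coefficients without bad pairs *)

Lemma count_iota_max (p : pred nat) l n : (0 < count p (iota l n))%N ->
  exists i, [/\ p i, i \in iota l n & (count p (iota l n) + l <= i.+1)%N].
Proof.
elim: n => // n IH.
have -> : iota l n.+1 = iota l n ++ [:: (l + n)%N] by rewrite -[n.+1]addn1 iotaD.
rewrite count_cat /= addn0.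
have [pl _|pl] := boolP (p (l + n)%N).
  exists (l + n)%N; split=> //; first by rewrite mem_cat inE eqxx orbT.
  have := count_size p (iota l n); rewrite size_iota; lia.
rewrite addn0 => /IH[i [pi il h]]; exists i; split=> //.
by rewrite mem_cat il.
Qed.

(** A selection of size [c] in an interval starting at [l] has an element that is at least
    [l + c - 1]. For two nonempty selections, the sum of these elements is below [t], so the sizes
    add up to at most [t + 1 - l1 - l2]; the bounds on [n1] and [n2] cover an empty selection. *)
Lemma count_iota_pair (p q : pred nat) l1 n1 l2 n2 t B :
  (forall i j, i \in iota l1 n1 -> j \in iota l2 n2 -> p i -> q j -> (i + j < t)%N) ->
  (n1 <= B)%N -> (n2 <= B)%N -> (t < B + l1 + l2)%N ->
  (count p (iota l1 n1) + count q (iota l2 n2) <= B)%N.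
Proof.
move=> h h1 h2 h3.
have c1 := count_size p (iota l1 n1); have c2 := count_size q (iota l2 n2).
rewrite !size_iota in c1 c2.
have [c10|/count_iota_max[i [pi il hi]]] := posnP (count p (iota l1 n1)); first lia.
have [c20|/count_iota_max[j [qj jl hj]]] := posnP (count q (iota l2 n2)); first lia.
have := h i j il jl pi qj; lia.
Qed.

(** The five unpaired families contribute at most [5 * tau + 2], and the three pairs of families at
    most [tau + 1], [tau + 1] and [tau + 2]. *)
Lemma card_no_bad (S : {set 'I_N}) : {subset S <= inU} ->
  (forall i j, i \in S -> j \in S -> ~~ bad i j) -> (#|S| <= 8 * tau + 6)%N.
Proof.
move=> SU nobad; pose P c := c \in map (@triple tau) (enum S).
have triple_inj : injective (@triple tau).
  move=> i j; rewrite /triple => e; apply: ord_inj.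
  have := uniq_coeffs tau; move: e; rewrite !(tnth_nth (Lg, 0, 0)%N) /= => e u.
  by apply/eqP; rewrite -(nth_uniq (Lg, 0, 0)%N _ _ u) ?e.
have le1 : (#|S| <= count P (essential tau))%N.
  rewrite cardE -(size_map (@triple tau) (enum S)) -size_filter; apply: uniq_leq_size.
    by rewrite map_inj_uniq ?enum_uniq.
  move=> c cS; rewrite mem_filter /P cS; move/mapP: cS => [i]; rewrite mem_enum => /SU Ui ->.
  exact: Ui.
apply: leq_trans le1 _.
(* An abstract [cnt] keeps the eleven counts opaque under simplification. *)
have [cnt cntE] : exists cnt, forall f, cnt f = count P (family_coeffs f) by eexists.
rewrite /essential count_flatten -map_comp -(eq_map cntE) /=.
have le f : (cnt f <= f.2.2)%N.
  rewrite cntE; apply: leq_trans (count_size _ _) _.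
  by rewrite size_map size_iota.
have pair p q r0 t l1 n1 l2 n2 B : (p, q, r0) \in lead_pairs ->
    r0 = (p.2 + q.2 + 6 * t)%N -> (n1 <= B)%N -> (n2 <= B)%N -> (t < B + l1 + l2)%N ->
    (cnt (p, (l1, n1)) + cnt (q, (l2, n2)) <= B)%N.
  move=> he er h1 h2 h3; rewrite !cntE /family_coeffs !count_map /=.
  have [hp hq] : (0 < p.2 <= 6)%N /\ (0 < q.2 <= 6)%N.
    apply/andP; apply: (allP (_ : all (fun e => (0 < e.1.1.2 <= 6) && (0 < e.1.2.2 <= 6))%N
      lead_pairs) _ he).
    by rewrite /lead_pairs.
  apply: count_iota_pair h1 h2 h3 => n m _ _ /mapP[i iS ti] /mapP[j jS tj].
  rewrite !mem_enum in iS jS; rewrite ltnNge; apply/negP => hr.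
  apply: (negP (nobad i j iS jS)); apply/and3P; split; [exact: SU | exact: SU |].
  apply/hasP; exists (p, q, r0) => //; rewrite /kind -ti -tj.
  have resE (u v : nat) : (0 < u <= 6)%N -> res6 (u + 6 * v) = u by rewrite /res6; lia.
  apply/and3P; split; last by rewrite er /=; lia.
    by rewrite /fst /snd resE // -surjective_pairing.
  by rewrite /fst /snd resE // -surjective_pairing.
(* The thresholds are [9 + 6 * tau = 5 + 4 + 6 * tau] and [11 + 6 * tau], which is both
   [4 + 1 + 6 * tau.+1] and [2 + 3 + 6 * tau.+1]. The family of [f_6^(1)] starts at index 1, so the
   second bound is one less than the third. *)
have p1 := @pair (Lg, 8, 5)%N (Lf, 8, 4)%N _ tau 0%N tau 0%N tau.+1 tau.+1.
have p2 := @pair (Lg, 8, 4)%N (Lf, 6, 1)%N _ tau.+1 0%N tau.+1 1%N tau tau.+1.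
have p3 := @pair (Lf, 10, 2)%N (Lf, 6, 3)%N _ tau.+1 0%N tau.+1 0%N tau.+1 tau.+2.
have {}p1 : (cnt (Lg, 8, 5, (0, tau)) + cnt (Lf, 8, 4, (0, tau.+1)) <= tau.+1)%N.
  by apply: (p1 (9 + 6 * tau)%N) => //=; [rewrite !inE eqxx | lia].
have {}p2 : (cnt (Lg, 8, 4, (0, tau.+1)) + cnt (Lf, 6, 1, (1, tau)) <= tau.+1)%N.
  by apply: (p2 (11 + 6 * tau)%N) => //=; do ?[by rewrite !inE eqxx orbT]; lia.
have {}p3 : (cnt (Lf, 10, 2, (0, tau.+1)) + cnt (Lf, 6, 3, (0, tau.+1)) <= tau.+2)%N.
  by apply: (p3 (11 + 6 * tau)%N) => //=; do ?[by rewrite !inE eqxx !orbT]; lia.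
have := le (Lf, 10, 1, (0, tau.+1))%N; have := le (Lg, 8, 2, (1, tau))%N.
have := le (Lg, 8, 6, (0, tau.+1))%N; have := le (Lg, 4, 6, (1, tau.-1))%N.
have := le (Lf, 8, 6, (0, tau.+1))%N; rewrite /=; lia.
Qed.

(** At most [8 * tau + 6] exponents are large, and fixing the weight removes one degree of
    freedom. *)
Lemma weight_space_growth : exists C, forall w (J : finType) (Phi : J -> T -> k),
  (forall j, F 0 w (Phi j)) ->
  (forall c : J -> k, \sum_j cst (c j) * Phi j = 0 -> forall j, c j = 0) ->
  (#|J| <= C * w.+1 ^ (8 * tau + 5))%N.
Proof.
have rk_le i : (rkU i <= 5)%N by rewrite /rkU /rank_of; case: ifP => _ //; case: ifP.
have := growth_upper_bound (@weight_gt0 tau) rk_le coordf_lin bad_nilp card_no_bad.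
by rewrite addnS.
Qed.

End LeadingRelations.

Theorem mainTheorem4 (k : closedFieldType)
    (char_neq2 : 2 \notin [pchar k]%R) (char_neq3 : 3 \notin [pchar k]%R)
    (tau : nat) (tau_gt0 : 0 < tau) :
  let H := generated_semigroup [:: 6; 2 + 6 * tau; 3 + 6 * tau;
                                   4 + 6 * tau; 5 + 6 * tau] in
  let g := 6 * tau + 1 in
  [/\ symmetric_semigroup H, has_genus H g,
      dim_le (moduli_space k tau) (8 * tau + 5),
      2 * g - 1 = 12 * tau + 1 &
      1 < tau -> 8 * tau + 5 < 2 * g - 1].
Proof.
move=> H g; split.
- exact: semigroup_symmetric.
- exact: semigroup_genus.
- apply: moduli_dim_le; apply: weight_space_growth => // x.
  by have [] := set_valP x.
- by rewrite /g; lia.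
- by rewrite /g; lia.
Qed.
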